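(* For every constant integer $k\ge 4$, the $k$-AP Hypothesis implies the $(k,k-1)$-Hyperclique Hypothesis.
   Context: A $k$-term arithmetic progression ($k$-AP) is a sequence $x,x+d,\dots,x+(k-1)d$; it is non-trivial if $d\neq 0$. $k$-AP Hypothesis: there is no algorithm that decides whether a given set $A\subseteq\{0,\dots,N\}$ contains a non-trivial $k$-AP in time $O(N^{2-\epsilon})$ for any constant $\epsilon>0$. $(k,h)$-Hyperclique Hypothesis: there is no algorithm that detects a $k$-clique (a set of $k$ vertices all of whose $h$-element subsets are hyperedges) in an $h$-uniform $n$-vertex hypergraph in time $O(n^{k-\epsilon})$ for any constant $\epsilon>0$. *)

(* Defs.v *)
From Stdlib Require PeanoNat.
From mathcomp Require Import all_boot all_order all_algebra.
From mathcomp Require Import all_classical all_reals all_analysis.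

Set Implicit Arguments.
Unset Strict Implicit.
Unset Printing Implicit Defensive.

Import Order.TTheory GRing.Theory Num.Theory.
Import numFieldNormedType.Exports.

(* The model of computation is the deterministic word RAM with w-bit words:    *)
(* words are naturals below 2 ^ w, arithmetic is modulo 2 ^ w, memory is       *)
(* addressed by words, and every primitive instruction takes unit time.        *)
(* Control flow is structured (sequence, branch, loop) rather than by jumps,   *)
(* which changes running times by at most a constant factor.                   *)

Inductive binop :=
  | OpAdd | OpSub | OpMul | OpDiv | OpMod | OpAnd
  | OpOr | OpXor | OpShl | OpShr | OpEq | OpLt.

(* Division by zero returns 0, and reduction modulo zero returns the dividend. *)
Definition eval_binop (w : nat) (o : binop) (a b : nat) : nat :=
  (match o with
   | OpAdd => a + b
   | OpSub => a + 2 ^ w - b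
   | OpMul => a * b
   | OpDiv => a %/ b
   | OpMod => a %% b
   | OpAnd => PeanoNat.Nat.land a b
   | OpOr => PeanoNat.Nat.lor a b
   | OpXor => PeanoNat.Nat.lxor a b
   | OpShl => a * 2 ^ b
   | OpShr => a %/ 2 ^ b
   | OpEq => a == b
   | OpLt => a < b
   end) %% 2 ^ w.

(* Registers are named by natural numbers; a program mentions finitely many.   *)
Inductive program :=
  | Const (x c : nat)
  | Binop (o : binop) (x y z : nat)
  | Read (x y : nat)
  | Write (x y : nat)
  | Skip
  | Seq (p q : program)
  | If (x : nat) (p q : program)
  | While (x : nat) (p : program).

Record state := State { reg : nat -> nat; memory : nat -> nat }.

Definition update (f : nat -> nat) (a v : nat) : nat -> nat :=
  fun b => if b == a then v else f b.

Definition set_reg (s : state) (x v : nat) : state :=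
  State (update (reg s) x v) (memory s).

Definition set_mem (s : state) (a v : nat) : state :=
  State (reg s) (update (memory s) a v).

(* exec w p s t s' : started in state s with word length w, the program p      *)
(* halts in state s' after exactly t steps.                                    *)
Inductive exec (w : nat) : program -> state -> nat -> state -> Prop :=
  | ExecConst x c s : exec w (Const x c) s 1 (set_reg s x (c %% 2 ^ w))
  | ExecBinop o x y z s :
      exec w (Binop o x y z) s 1
        (set_reg s x (eval_binop w o (reg s y) (reg s z)))
  | ExecRead x y s : exec w (Read x y) s 1 (set_reg s x (memory s (reg s y)))
  | ExecWrite x y s : exec w (Write x y) s 1 (set_mem s (reg s x) (reg s y))
  | ExecSkip s : exec w Skip s 1 s
  | ExecSeq p q s s1 s2 t1 t2 :
      exec w p s t1 s1 -> exec w q s1 t2 s2 ->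
      exec w (Seq p q) s (t1 + t2) s2
  | ExecIfTrue x p q s s1 t :
      reg s x != 0 -> exec w p s t s1 -> exec w (If x p q) s t.+1 s1
  | ExecIfFalse x p q s s1 t :
      reg s x = 0 -> exec w q s t s1 -> exec w (If x p q) s t.+1 s1
  | ExecWhileTrue x p s s1 s2 t1 t2 :
      reg s x != 0 -> exec w p s t1 s1 -> exec w (While x p) s1 t2 s2 ->
      exec w (While x p) s (t1 + t2).+1 s2
  | ExecWhileFalse x p s :
      reg s x = 0 -> exec w (While x p) s 1 s.

(* The input occupies an initial segment of a memory that is zero elsewhere.   *)
Definition init_state (xs : seq nat) : state :=
  State (fun _ => 0) (fun a => nth 0 xs a).

(* Running times are functions of input_size, not of size (encode x).          *)
Record problem := Problem {
  instance : Type;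
  input_size : instance -> nat;
  encode : instance -> seq nat;
  yes_instance : instance -> Prop }.

(* w >= c * log2 (n + 2), and w-bit words can hold and address the input.      *)
Definition word_length_ok (c n : nat) (xs : seq nat) (w : nat) : bool :=
  [&& n.+2 ^ c <= 2 ^ w, size xs <= 2 ^ w & all (fun v => v < 2 ^ w) xs].

(* The program is oblivious to the word length, which may be any               *)
(* w >= c * log2 (n + 2). Register 0 is nonzero on halting iff the answer      *)
(* is yes.                                                                     *)
Definition decides_within
    (P : problem) (p : program) (c : nat) (T : nat -> nat) : Prop :=
  forall (x : instance P) (w : nat),
    word_length_ok c (input_size x) (encode x) w ->
    exists (t : nat) (s : state),
      [/\ exec w p (init_state (encode x)) t s,
          t <= T (input_size x)
        & reg s 0 != 0 <-> yes_instance x].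

Local Open Scope classical_set_scope.
Local Open Scope ring_scope.

Definition solvable_in_bigO (R : realType) (P : problem) (f : nat -> R) : Prop :=
  exists (p : program) (c : nat) (T : nat -> nat),
    decides_within P p c T /\ (fun n => (T n)%:R : R) =O_\oo f.

Definition has_nontrivial_AP (k N : nat) (A : {set 'I_N.+1}) : Prop :=
  exists x d : int, d != 0 /\
    forall i : nat, (i < k)%N -> exists2 a : 'I_N.+1, a \in A & a%:Z = x + i%:Z * d.

(* N followed by the N + 1 bits of the characteristic vector of A              *)
Definition encode_set (I : {N : nat & {set 'I_N.+1}}) : seq nat :=
  projT1 I :: [seq nat_of_bool (i \in projT2 I) | i <- enum 'I_(projT1 I).+1].

Definition AP_problem (k : nat) : problem :=
  @Problem {N : nat & {set 'I_N.+1}} (fun I => projT1 I) encode_set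
    (fun I => has_nontrivial_AP k (projT2 I)).

Definition AP_hypothesis (R : realType) (k : nat) : Prop :=
  forall eps : R, 0 < eps ->
    ~ solvable_in_bigO (AP_problem k) (fun N => N%:R `^ (2 - eps)).

Record hypergraph (h : nat) := Hypergraph {
  nvertices : nat;
  hyperedges : {set {set 'I_nvertices}};
  uniform : forall e, e \in hyperedges -> #|e| = h }.

Definition is_clique (h : nat) (G : hypergraph h) (K : {set 'I_(nvertices G)}) : Prop :=
  forall e : {set 'I_(nvertices G)}, e \subset K -> #|e| = h -> e \in hyperedges G.

Definition has_clique (k h : nat) (G : hypergraph h) : Prop :=
  exists2 K : {set 'I_(nvertices G)}, #|K| = k & is_clique K.

(* The vertices occurring among the h base-n digits of j.                      *)
Definition digit_set (n h j : nat) : {set 'I_n} :=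
  [set v : 'I_n | [exists i : 'I_h, nat_of_ord v == (j %/ n ^ i %% n)%N]].

(* n followed by the n ^ h entries of the adjacency tensor, the entry at the   *)
(* vertices v_0, ..., v_(h-1) being at offset v_0 + v_1 n + ... + v_(h-1)      *)
(* n ^ (h-1).                                                                  *)
Definition encode_hypergraph (h : nat) (G : hypergraph h) : seq nat :=
  nvertices G :: [seq nat_of_bool (digit_set (nvertices G) h j \in hyperedges G)
                       | j <- iota 0 (nvertices G ^ h)].

Definition hyperclique_problem (k h : nat) : problem :=
  @Problem (hypergraph h) (@nvertices h) (@encode_hypergraph h) (@has_clique k h).

Definition hyperclique_hypothesis (R : realType) (k h : nat) : Prop :=
  forall eps : R, 0 < eps ->
    ~ solvable_in_bigO (hyperclique_problem k h) (fun n => n%:R `^ (k%:R - eps)).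

(* Main.v *)
Require Import Defs.
From mathcomp Require Import all_boot all_order all_algebra.
From mathcomp Require Import all_classical all_reals all_analysis.
From mathcomp Require Import zify ring lra.

(* Given [A], fix [r] a power of [k] with [sqrt N < r ^ k = O(sqrt N)] and let
   [L = r ^ k]. A vertex in part [i < k] is a pair of base-[r] digits [s, t] and
   contributes the integer [f = s r ^ i + t r ^ (i - 1 mod k)] in direction
   [(-i, 1)] to the pair (start, difference). For an offset [(X0, D0)], vertices
   [v_j] from distinct parts other than [i] form a hyperedge when
   [X0 + i D0 + sum_j (i - j) f(v_j)] is in [A]; this is the [i]-th term of the
   progression with start [X0 - sum_j j f(v_j)] and difference
   [D0 + sum_j f(v_j)], and it does not depend on [v_i]. Hence [k]-cliques are
   progressions. As digit [j] is used by the parts [j] and [j + 1 mod k], whose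
   directions have determinant [1] or [1 - k], invertible modulo [r], the cliques
   reach every residue of (start, difference) modulo [L]. The [O((N / L) ^ 2)]
   offsets in [L Z x L Z] with [D0 > 0] therefore cover all progressions of
   difference at least [2 L], and the others are found by brute force in time
   [O(N ^ (3 / 2))]. Each hypergraph has [n = k r ^ 2] vertices, with
   [n ^ k = k ^ k L ^ 2], so saving [n ^ eps] on every instance saves
   [N ^ (eps / k)] in total. On the RAM, every call of the hyperclique program
   runs in a fresh zero region of memory, with a word length just logarithmic
   in [N]. *)

Set Implicit Arguments.
Unset Strict Implicit.
Unset Printing Implicit Defensive.

Import Order.TTheory GRing.Theory Num.Theory.

(** * Expressions and loops *)

Inductive var := Found | Size | Base | Modulus | Outer | Inner | Offset.

Record env := Env {
  found : nat; size_ : nat; base : nat; modulus : nat;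
  outer : nat; inner : nat; offset : nat }.

Definition get (v : env) (x : var) : nat :=
  match x with
  | Found => found v | Size => size_ v | Base => base v | Modulus => modulus v
  | Outer => outer v | Inner => inner v | Offset => offset v
  end.

Definition set (v : env) (x : var) (a : nat) : env :=
  let: Env f s b m o i z := v in
  match x with
  | Found => Env a s b m o i z | Size => Env f a b m o i z
  | Base => Env f s a m o i z | Modulus => Env f s b a o i z
  | Outer => Env f s b m a i z | Inner => Env f s b m o a z
  | Offset => Env f s b m o i a
  end.

Definition var_reg (x : var) : nat :=
  match x with
  | Found => 0 | Size => 1 | Base => 2 | Modulus => 3
  | Outer => 4 | Inner => 5 | Offset => 6
  end.

Definition nvars := 7.

Definition env_of (s : state) : env :=
  Env (reg s 0) (reg s 1) (reg s 2) (reg s 3) (reg s 4) (reg s 5) (reg s 6).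

Lemma get_env_of s x : get (env_of s) x = reg s (var_reg x).
Proof. by case: x. Qed.

Lemma env_of_eq s s' :
  (forall y, y < nvars -> reg s' y = reg s y) -> env_of s' = env_of s.
Proof. by move=> E; rewrite /env_of !E. Qed.

Lemma env_of_set s s' x :
  (forall y, y < nvars -> y != var_reg x -> reg s' y = reg s y) ->
  env_of s' = set (env_of s) x (reg s' (var_reg x)).
Proof. by case: x => E; rewrite /env_of /=; congr Env; apply: E. Qed.

Inductive arith := Add | Sub | Mul | Div | Mod | Eq | Lt.

Definition arith_den (o : arith) (a b : nat) : nat :=
  match o with
  | Add => a + b | Sub => a - b | Mul => a * b | Div => a %/ b
  | Mod => a %% b | Eq => a == b | Lt => a < b
  end.

Definition arith_op (o : arith) : binop :=
  match o with
  | Add => OpAdd | Sub => OpSub | Mul => OpMul | Div => OpDiv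
  | Mod => OpMod | Eq => OpEq | Lt => OpLt
  end.

Inductive expr :=
  | Var (x : var)
  | Num (c : nat)
  | Op (o : arith) (e1 e2 : expr)
  | Mem (e : expr).

Fixpoint den (v : env) (m : nat -> nat) (e : expr) : nat :=
  match e with
  | Var x => get v x
  | Num c => c
  | Op o e1 e2 => arith_den o (den v m e1) (den v m e2)
  | Mem e => m (den v m e)
  end.

(* Chosen so that [den v m e <= X ^ weight e] when all variables and memory
   cells are at most [X >= 2]: computations are free of overflow as soon as
   [2 ^ w] exceeds a constant power of [X]. *)
Fixpoint weight (e : expr) : nat :=
  match e with
  | Var _ => 1
  | Num c => c.+1
  | Op _ e1 e2 => weight e1 + weight e2
  | Mem e => weight e
  end.

Definition bounded (X : nat) (v : env) (m : nat -> nat) : Prop :=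
  (forall x, get v x <= X) /\ (forall a, m a <= X).

Lemma weight_gt0 e : 0 < weight e.
Proof. elim: e => //= _ e1 + e2 _; lia. Qed.

Lemma leq_add_expn X a b i j :
  1 < X -> 0 < i -> 0 < j -> a <= X ^ i -> b <= X ^ j -> a + b <= X ^ (i + j).
Proof.
move=> X1 i0 j0 ha hb; rewrite expnD.
have hi : 1 < X ^ i by rewrite -{1}(exp1n i) ltn_exp2r.
have hj : 1 < X ^ j by rewrite -{1}(exp1n j) ltn_exp2r.
by apply: leq_trans (leq_add ha hb) _; nia.
Qed.

Lemma den_le X v m e :
  1 < X -> bounded X v m -> den v m e <= X ^ weight e.
Proof.
move=> X1 [bv bm]; elim: e => [x|c|o e1 h1 e2 h2|e _] /=.
- by rewrite expn1.
- by apply: ltnW; apply: leq_trans (ltn_expl c.+1 X1); lia.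
- have g1 := weight_gt0 e1; have g2 := weight_gt0 e2.
  have hle a : a <= X ^ weight e1 -> a <= X ^ (weight e1 + weight e2).
    by move/leq_trans; apply; rewrite leq_exp2l //; lia.
  have hb (b : bool) : b <= X ^ (weight e1 + weight e2).
    by apply: leq_trans (leq_b1 b) _; rewrite expn_gt0; lia.
  case: o => //=.
  + exact: leq_add_expn.
  + by apply: hle; apply: leq_trans (leq_subr _ _) h1.
  + by rewrite expnD leq_mul.
  + by apply: hle; apply: leq_trans (leq_div _ _) h1.
  + by apply: hle; apply: leq_trans (leq_mod _ _) h1.
- by apply: leq_trans (bm _) _; rewrite -{1}(expn1 X) leq_exp2l ?weight_gt0.
Qed.

Fixpoint compile (e : expr) (d : nat) : program :=
  match e with
  | Var x => Binop OpOr d (var_reg x) (var_reg x)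
  | Num c => Const d c
  | Op o e1 e2 =>
      Seq (compile e1 d) (Seq (compile e2 d.+1)
        (if o is Sub then
           Seq (Binop OpLt d.+2 d.+1 d)
             (Seq (Binop OpSub d d d.+1) (Binop OpMul d d d.+2))
         else Binop (arith_op o) d d d.+1))
  | Mem e => Seq (compile e d) (Read d d)
  end.

Fixpoint cost (e : expr) : nat :=
  match e with
  | Var _ | Num _ => 1
  | Op o e1 e2 => cost e1 + (cost e2 + (if o is Sub then 3 else 1))
  | Mem e => cost e + 1
  end.

Section Execution.
Variable w : nat.

Lemma eval_arith o a b :
  o <> Sub -> arith_den o a b < 2 ^ w ->
  eval_binop w (arith_op o) a b = arith_den o a b.
Proof. by case: o => //= _ h; rewrite /eval_binop modn_small. Qed.

Lemma eval_monus a b : a < 2 ^ w -> b < 2 ^ w ->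
  eval_binop w OpMul (eval_binop w OpSub a b) (eval_binop w OpLt b a) = a - b.
Proof.
move=> ha hb; rewrite /eval_binop.
have w0 : 0 < 2 ^ w by rewrite expn_gt0.
case: (ltnP b a) => h.
  have -> : a + 2 ^ w - b = (a - b) + 2 ^ w by lia.
  rewrite modnMmr muln1 modnDr modn_mod modn_small //; lia.
by rewrite mod0n muln0 mod0n; lia.
Qed.

Lemma exec_compile X e d s :
  1 < X -> X ^ weight e < 2 ^ w -> nvars <= d ->
  bounded X (env_of s) (memory s) ->
  exists s', [/\ exec w (compile e d) s (cost e) s',
    reg s' d = den (env_of s) (memory s) e,
    forall y, y < d -> reg s' y = reg s y & memory s' = memory s].
Proof.
move=> X1; elim: e d s => [x|c|o e1 h1 e2 h2|e h] d s hw hd hb.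
- eexists; split; first exact: ExecBinop.
  + rewrite /= /update eqxx /eval_binop PeanoNat.Nat.lor_diag -get_env_of.
    by rewrite modn_small //; apply: leq_ltn_trans (den_le (Var x) X1 hb) _.
  + by move=> y yd; rewrite /= /update ltn_eqF.
  + by [].
- eexists; split; first exact: ExecConst.
  + rewrite /= /update eqxx modn_small //.
    exact: leq_ltn_trans (den_le (Num c) X1 hb) _.
  + by move=> y yd; rewrite /= /update ltn_eqF.
  + by [].
- have g1 := weight_gt0 e1; have g2 := weight_gt0 e2.
  have hw1 : X ^ weight e1 < 2 ^ w.
    by apply: leq_ltn_trans hw; rewrite leq_exp2l //=; lia.
  have hw2 : X ^ weight e2 < 2 ^ w.
    by apply: leq_ltn_trans hw; rewrite leq_exp2l //=; lia.
  have [s1 [E1 R1 F1 M1]] := h1 d s hw1 hd hb.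
  have hs1 : env_of s1 = env_of s.
    by apply: env_of_eq => y yn; apply: F1; apply: leq_trans hd.
  have hb1 : bounded X (env_of s1) (memory s1) by rewrite hs1 M1.
  have [s2 [E2 R2 F2 M2]] := h2 d.+1 s1 hw2 (leqW hd) hb1.
  have F y : y < d -> reg s2 y = reg s y.
    by move=> yd; rewrite F2 ?F1 //; lia.
  have Rd : reg s2 d = den (env_of s) (memory s) e1 by rewrite F2 ?R1.
  have Rd1 : reg s2 d.+1 = den (env_of s) (memory s) e2 by rewrite R2 hs1 M1.
  have l1 := leq_ltn_trans (den_le e1 X1 hb) hw1.
  have l2 := leq_ltn_trans (den_le e2 X1 hb) hw2.
  have l := leq_ltn_trans (den_le (Op o e1 e2) X1 hb) hw.
  case: (pselect (o = Sub)) => [-> | no].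
    eexists; split.
    + apply: ExecSeq E1 _; apply: ExecSeq E2 _.
      have -> : 3 = 1 + (1 + 1) by [].
      apply: ExecSeq; first exact: ExecBinop.
      apply: ExecSeq; exact: ExecBinop.
    + rewrite /= /update !eqxx Rd Rd1.
      have -> /= : (d.+2 == d) = false by lia.
      have -> /= : (d == d.+2) = false by lia.
      have -> /= : (d.+1 == d.+2) = false by lia.
      by rewrite eval_monus.
    + move=> y yd; rewrite /= /update.
      have -> : (y == d) = false by lia.
      have -> : (y == d.+2) = false by lia.
      exact: F.
    + by rewrite /= M2 M1.
  exists (set_reg s2 d (eval_binop w (arith_op o) (reg s2 d) (reg s2 d.+1))).
  split.
  + have E : exec w (Binop (arith_op o) d d d.+1) s2 1
       (set_reg s2 d (eval_binop w (arith_op o) (reg s2 d) (reg s2 d.+1))).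
      exact: ExecBinop.
    by case: o no E {l hw} => // no E;
       apply: ExecSeq E1 _; apply: ExecSeq E2 E.
  + by rewrite /= /update eqxx Rd Rd1 eval_arith.
  + by move=> y yd; rewrite /= /update ltn_eqF //; exact: F.
  + by rewrite /= M2 M1.
- have [s1 [E1 R1 F1 M1]] := h d s hw hd hb.
  eexists; split.
  + by apply: ExecSeq E1 _; exact: ExecRead.
  + by rewrite /= /update eqxx R1 M1.
  + by move=> y yd; rewrite /= /update ltn_eqF //; exact: F1.
  + by [].
Qed.

Definition assertion := env -> (nat -> nat) -> Prop.

Definition triple (P : assertion) (p : program) (T : nat) (Q : assertion) :=
  forall s, P (env_of s) (memory s) -> exists t s',
    [/\ exec w p s t s', t <= T & Q (env_of s') (memory s')].

Lemma triple_weaken P P' p T T' Q Q' :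
  triple P p T Q -> (forall v m, P' v m -> P v m) -> T <= T' ->
  (forall v m, Q v m -> Q' v m) -> triple P' p T' Q'.
Proof.
move=> h hP hT hQ s /hP /h[t [s' [E l q]]]; exists t, s'.
by split=> //; [apply: leq_trans hT | apply: hQ].
Qed.

Lemma triple_seq P Q R p q T1 T2 :
  triple P p T1 Q -> triple Q q T2 R -> triple P (Seq p q) (T1 + T2) R.
Proof.
move=> hp hq s /hp[t1 [s1 [E1 l1 /hq[t2 [s2 [E2 l2 r]]]]]].
by exists (t1 + t2), s2; split=> //; [apply: ExecSeq E1 E2 | apply: leq_add].
Qed.

Definition assign (x : var) (e : expr) : program :=
  Seq (compile e nvars) (Binop OpOr (var_reg x) nvars nvars).

Definition store (e1 e2 : expr) : program :=
  Seq (compile e1 nvars) (Seq (compile e2 nvars.+1) (Write nvars nvars.+1)).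

Section Bound.
Variable X : nat.
Hypothesis X1 : 1 < X.

Lemma triple_assign x e Q : X ^ weight e < 2 ^ w ->
  triple (fun v m => bounded X v m /\ Q (set v x (den v m e)) m)
    (assign x e) (cost e).+1 Q.
Proof.
move=> hw s [hb q].
have [s1 [E R F M]] := exec_compile X1 hw (leqnn nvars) hb.
exists (cost e + 1); eexists; split.
- by apply: ExecSeq E _; exact: ExecBinop.
- by rewrite addn1.
rewrite /= M; suff -> : env_of (set_reg s1 (var_reg x)
     (eval_binop w OpOr (reg s1 nvars) (reg s1 nvars))) =
   set (env_of s) x (den (env_of s) (memory s) e) by [].
rewrite (@env_of_set s _ x) => [|y yn yx]; last by rewrite /= /update (negPf yx) F.
rewrite /= /update eqxx R /eval_binop PeanoNat.Nat.lor_diag modn_small //.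
exact: leq_ltn_trans (den_le e X1 hb) hw.
Qed.

Lemma triple_store e1 e2 Q : X ^ weight e1 < 2 ^ w -> X ^ weight e2 < 2 ^ w ->
  triple (fun v m => bounded X v m /\ Q v (update m (den v m e1) (den v m e2)))
    (store e1 e2) (cost e1 + cost e2).+1 Q.
Proof.
move=> hw1 hw2 s [hb q].
have [s1 [E1 R1 F1 M1]] := exec_compile X1 hw1 (leqnn nvars) hb.
have hs1 : env_of s1 = env_of s by exact: env_of_eq.
have hb1 : bounded X (env_of s1) (memory s1) by rewrite hs1 M1.
have [s2 [E2 R2 F2 M2]] := exec_compile X1 hw2 (leqW (leqnn nvars)) hb1.
exists (cost e1 + (cost e2 + 1)); eexists; split.
- by apply: ExecSeq E1 _; apply: ExecSeq E2 _; exact: ExecWrite.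
- by lia.
have r1 : reg s2 nvars = den (env_of s) (memory s) e1 by rewrite F2 ?R1.
have r2 : reg s2 nvars.+1 = den (env_of s) (memory s) e2 by rewrite R2 hs1 M1.
rewrite r1 r2.
have -> : env_of (Defs.set_mem s2 (den (env_of s) (memory s) e1)
   (den (env_of s) (memory s) e2)) = env_of s.
  by rewrite -hs1; apply: env_of_eq => y yn; rewrite /= F2 // (leq_trans yn).
by rewrite [memory _]/= M2 M1.
Qed.

Definition for_loop (x : var) (e : expr) (body : program) : program :=
  let test := compile (Op Lt (Var x) e) nvars in
  Seq (assign x (Num 0)) (Seq test
    (While nvars (Seq body (Seq (assign x (Op Add (Var x) (Num 1))) test)))).

Lemma triple_for x e body n T (Inv : nat -> assertion) :
  X ^ (weight e + 3) < 2 ^ w ->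
  (forall j v m, j <= n -> Inv j v m ->
     [/\ get v x = j, den v m e = n & bounded X v m]) ->
  (forall j, j < n -> triple (Inv j) body T
     (fun v m => [/\ get v x = j, bounded X v m & Inv j.+1 (set v x j.+1) m])) ->
  triple (fun v m => bounded X v m /\ Inv 0 (set v x 0) m)
    (for_loop x e body) (n * (T + cost e + 10) + (cost e + 10)) (Inv n).
Proof.
move=> hw hI hbody.
have hw' : X ^ weight (Op Lt (Var x) e) < 2 ^ w.
  by apply: leq_ltn_trans hw; rewrite leq_exp2l //=; lia.
have hw0 : X ^ weight (Num 0) < 2 ^ w.
  by apply: leq_ltn_trans hw; rewrite leq_exp2l //=; lia.
have hw1 : X ^ weight (Op Add (Var x) (Num 1)) < 2 ^ w.
  by apply: leq_ltn_trans hw; rewrite leq_exp2l //=; lia.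
pose test := compile (Op Lt (Var x) e) nvars.
have htest j s : j <= n -> Inv j (env_of s) (memory s) -> exists s',
    [/\ exec w test s (cost e + 2) s', reg s' nvars = (j < n)%N,
        env_of s' = env_of s & memory s' = memory s].
  move=> jn hi; have [gx ge hb] := hI _ _ _ jn hi.
  have [s1 [E R F M]] := exec_compile X1 hw' (leqnn nvars) hb.
  exists s1; split=> //.
  - by move: E => /=; rewrite add1n addn1 addn2.
  - by rewrite R /= gx ge.
  - exact: env_of_eq.
have hloop d j s : d = n - j -> j <= n -> reg s nvars = (j < n)%N ->
    Inv j (env_of s) (memory s) -> exists t s',
    [/\ exec w (While nvars
          (Seq body (Seq (assign x (Op Add (Var x) (Num 1))) test))) s t s',
        t <= d * (T + cost e + 10) + 1 & Inv n (env_of s') (memory s')].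
  elim: d j s => [|d IH] j s dn jn rs hi.
    have ejn : j = n by lia.
    subst j; exists 1, s; split=> //; apply: ExecWhileFalse.
    by rewrite rs ltnn.
  have ltjn : j < n by lia.
  have [t1 [s1 [E1 l1 [g1 b1 i1]]]] := hbody j ltjn s hi.
  have [|t2 [s2 [E2 l2 i2]]] := @triple_assign x (Op Add (Var x) (Num 1))
      (Inv j.+1) hw1 s1.
    by split=> //=; rewrite g1 addn1.
  have [s3 [E3 r3 e3 m3]] := htest _ _ ltjn i2.
  have [||||t4 [s4 [E4 l4 i4]]] := IH j.+1 s3; rewrite ?e3 ?m3 //; first lia.
  exists (t1 + (t2 + (cost e + 2)) + t4).+1, s4; split=> //.
    apply: ExecWhileTrue E4; first by rewrite rs ltjn.
    by apply: ExecSeq E1 _; apply: ExecSeq E2 E3.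
  by move: l2 => /=; lia.
move=> s [hb h0].
have [//|t1 [s1 [E1 l1 i1]]] := @triple_assign x (Num 0) (Inv 0) hw0 s.
have [s2 [E2 r2 e2 m2]] := htest 0 s1 (leq0n n) i1.
have [||||t3 [s3 [E3 l3 i3]]] := hloop n 0 s2; rewrite ?e2 ?m2 ?subn0 //.
exists (t1 + (cost e + 2 + t3)), s3; split=> //.
  by apply: ExecSeq E1 _; apply: ExecSeq E2 E3.
by move: l1 => /=; lia.
Qed.

End Bound.
End Execution.

(** * Simulation with a shorter word length *)

Fixpoint reg_bound (p : program) : nat :=
  match p with
  | Const x _ => x.+1
  | Binop _ x y z => maxn x.+1 (maxn y.+1 z.+1)
  | Read x y | Write x y => maxn x.+1 y.+1
  | Skip => 0
  | Seq p q => maxn (reg_bound p) (reg_bound q)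
  | If x p q => maxn x.+1 (maxn (reg_bound p) (reg_bound q))
  | While x p => maxn x.+1 (reg_bound p)
  end.

(* Runs [p] with the word length [log2 Modulus] on the [Modulus] memory cells
   starting at [Offset]; the registers of [p] are shifted past the variables
   and register [nvars + m] holds translated addresses. *)
Fixpoint simulate (m : nat) (p : program) : program :=
  match p with
  | Const x c => Seq (Const (nvars + x) c)
      (Binop OpMod (nvars + x) (nvars + x) (var_reg Modulus))
  | Binop o x y z => Seq (Binop o (nvars + x) (nvars + y) (nvars + z))
      (Binop OpMod (nvars + x) (nvars + x) (var_reg Modulus))
  | Read x y => Seq (Binop OpAdd (nvars + m) (var_reg Offset) (nvars + y))
      (Read (nvars + x) (nvars + m))
  | Write x y => Seq (Binop OpAdd (nvars + m) (var_reg Offset) (nvars + x))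
      (Write (nvars + m) (nvars + y))
  | Skip => Skip
  | Seq p q => Seq (simulate m p) (simulate m q)
  | If x p q => If (nvars + x) (simulate m p) (simulate m q)
  | While x p => While (nvars + x) (simulate m p)
  end.

Section Simulation.
Variables (w w' B m : nat).

Record simulates (s u : state) : Prop := Simulates {
  sim_reg : forall x, x < m -> reg u (nvars + x) = reg s x;
  sim_reg_lt : forall x, x < m -> reg s x < 2 ^ w';
  sim_mem : forall a, a < 2 ^ w' -> memory u (B + a) = memory s a;
  sim_mem_lt : forall a, memory s a < 2 ^ w';
  sim_modulus : reg u (var_reg Modulus) = 2 ^ w';
  sim_offset : reg u (var_reg Offset) = B }.

Record framed (u u' : state) : Prop := Framed {
  framed_reg : forall y, y < nvars -> reg u' y = reg u y;
  framed_mem : forall a, ~~ (B <= a < B + 2 ^ w') -> memory u' a = memory u a }.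

Lemma framed_refl u : framed u u. Proof. by split. Qed.

Lemma framed_trans u1 u2 u3 : framed u1 u2 -> framed u2 u3 -> framed u1 u3.
Proof.
by move=> [r1 m1] [r2 m2]; split=> z hz; rewrite ?r2 ?m2 // ?r1 ?m1.
Qed.

Lemma eval_binop_mod o a b : w' <= w -> b < 2 ^ w' ->
  eval_binop w OpMod (eval_binop w o a b) (2 ^ w') = eval_binop w' o a b.
Proof.
move=> ww hb; have hd : 2 ^ w' %| 2 ^ w by rewrite dvdn_exp2l.
have h0 : 0 < 2 ^ w' by rewrite expn_gt0.
have hle : 2 ^ w' <= 2 ^ w by rewrite leq_exp2l.
rewrite {1}/eval_binop modn_small; last first.
  by apply: leq_trans hle; rewrite ltn_pmod.
case: o; rewrite /eval_binop modn_dvdm //.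
have -> : a + 2 ^ w - b = (a + 2 ^ w' - b) + (2 ^ w - 2 ^ w') by lia.
by rewrite -modnDmr; have /eqP -> := dvdn_sub hd (dvdnn (2 ^ w')); rewrite addn0.
Qed.

Lemma simulates_set_reg s u x v : v < 2 ^ w' -> simulates s u ->
  simulates (set_reg s x v) (set_reg u (nvars + x) v).
Proof.
move=> hv [h1 h2 h3 h4 h5 h6]; split=> //=.
- by move=> y ym; rewrite /update eqn_add2l; case: ifP => // _; apply: h1.
- by move=> y ym; rewrite /update; case: ifP => // _; apply: h2.
Qed.

Lemma framed_set_reg u u' x v :
  framed u u' -> framed u (set_reg u' (nvars + x) v).
Proof.
move=> [h1 h2]; split=> // y yn; rewrite /= /update.
have -> : (y == nvars + x) = false by apply/eqP; lia.
exact: h1.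
Qed.

Lemma simulates_set_tmp s u v : simulates s u ->
  simulates s (set_reg u (nvars + m) v).
Proof.
move=> [h1 h2 h3 h4 h5 h6]; split=> //=.
move=> y ym; rewrite /update eqn_add2l ltn_eqF //; exact: h1.
Qed.

Lemma eval_binop_lt o a b : eval_binop w' o a b < 2 ^ w'.
Proof. by rewrite /eval_binop ltn_pmod // expn_gt0. Qed.

Lemma set_regK u x a b : set_reg (set_reg u x a) x b = set_reg u x b.
Proof.
by congr State; apply/funext => y; rewrite /= /update; case: eqP.
Qed.

Lemma exec_simulate p s t s' : w' <= w -> B + 2 ^ w' <= 2 ^ w ->
  exec w' p s t s' -> reg_bound p <= m -> forall u, simulates s u ->
  exists t' u', [/\ exec w (simulate m p) u t' u', t' <= 2 * t,
    simulates s' u' & framed u u'].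
Proof.
move=> ww hB; elim => {p s t s'}.
- move=> x c s _ u su; exists (1 + 1); eexists; split; [ | by [] | | ].
  + apply: ExecSeq; [exact: ExecConst | exact: ExecBinop].
  + rewrite set_regK.
    rewrite [X in set_reg u _ X](_ : _ = c %% 2 ^ w').
      by apply: simulates_set_reg su; rewrite ltn_pmod // expn_gt0.
    rewrite /= /update eqxx (sim_modulus su) /eval_binop.
    rewrite modn_small; first by rewrite modn_dvdm ?dvdn_exp2l.
    by rewrite (@leq_trans (2 ^ w')) ?leq_exp2l // ltn_pmod // expn_gt0.
  + do 2! apply: framed_set_reg; exact: framed_refl.
- move=> o x y z s /= hm u su; exists (1 + 1); eexists; split; [ | by [] | | ].
  + apply: ExecSeq; exact: ExecBinop.
  + rewrite set_regK.
    rewrite [X in set_reg u _ X](_ : _ = eval_binop w' o (reg s y) (reg s z)).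
      by apply: simulates_set_reg su; apply: eval_binop_lt.
    rewrite [in LHS]/= /update eqxx (sim_modulus su) !(sim_reg su); [|lia..].
    by rewrite eval_binop_mod //; apply: (sim_reg_lt su); lia.
  + do 2! apply: framed_set_reg; exact: framed_refl.
- move=> x y s /= hm u su; exists (1 + 1); eexists; split; [ | by [] | | ].
  + apply: ExecSeq; [exact: ExecBinop | exact: ExecRead].
  + have hy := sim_reg_lt su (x := y) ltac:(lia).
    have hy' := sim_reg su (x := y) ltac:(lia).
    set v := set_reg u _ _.
    have -> : memory v (reg v (nvars + m)) = memory s (reg s y).
      rewrite /v /= /update eqxx (sim_offset su) hy' /eval_binop modn_small; last lia.
      exact: (sim_mem su).
    apply: simulates_set_reg; first exact: (sim_mem_lt su).
    exact: simulates_set_tmp.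
  + by do 2! apply: framed_set_reg; exact: framed_refl.
- move=> x y s /= hm u su; exists (1 + 1); eexists; split; [ | by [] | | ].
  + apply: ExecSeq; [exact: ExecBinop | exact: ExecWrite].
  + have hx := sim_reg_lt su (x := x) ltac:(lia).
    have hx' := sim_reg su (x := x) ltac:(lia).
    have hy := sim_reg_lt su (x := y) ltac:(lia).
    have hy' := sim_reg su (x := y) ltac:(lia).
    have := simulates_set_tmp (eval_binop w OpAdd (reg u (var_reg Offset))
       (reg u (nvars + x))) su.
    set v := set_reg u _ _ => sv; have [h1 h2 h3 h4 h5 h6] := sv.
    have -> : reg v (nvars + m) = B + reg s x.
      rewrite /v /= /update eqxx hx' (sim_offset su) /eval_binop modn_small //; lia.
    rewrite h1; last lia.
    split=> //= a; rewrite /update.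
    * by rewrite eqn_add2l => am; case: ifP => // _; apply: h3.
    * by case: ifP => // _; apply: h4.
  + split=> /=.
      move=> z zn; rewrite /= /update.
      by have -> : (z == nvars + m) = false by apply/eqP; lia.
    move=> a ha; rewrite /update ifF // eqxx (sim_offset su).
    have hx := sim_reg_lt su (x := x) ltac:(lia).
    have hx' := sim_reg su (x := x) ltac:(lia).
    rewrite hx' /eval_binop modn_small; last lia.
    by apply/eqP; lia.
- move=> s _ u su; exists 1, u; split; [exact: ExecSkip | by [] | by [] | exact: framed_refl].
- move=> p q s s1 s2 t1 t2 _ IH1 _ IH2 /=; rewrite geq_max => /andP[hp hq] u su.
  have [t1' [u1 [E1 l1 su1 f1]]] := IH1 hp u su.
  have [t2' [u2 [E2 l2 su2 f2]]] := IH2 hq u1 su1.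
  exists (t1' + t2'), u2; split=> //; [exact: ExecSeq E1 E2 | lia |].
  exact: framed_trans f1 f2.
- move=> x p q s s1 t hx _ IH /= hm u su.
  have [|t' [u' [E l su' f]]] := IH _ u su; first lia.
  exists t'.+1, u'; split=> //; last lia.
  by apply: ExecIfTrue => //; rewrite (sim_reg su) //; lia.
- move=> x p q s s1 t hx _ IH /= hm u su.
  have [|t' [u' [E l su' f]]] := IH _ u su; first lia.
  exists t'.+1, u'; split=> //; last lia.
  by apply: ExecIfFalse => //; rewrite (sim_reg su) //; lia.
- move=> x p s s1 s2 t1 t2 hx _ IH1 _ IH2 /= hm u su.
  have [|t1' [u1 [E1 l1 su1 f1]]] := IH1 _ u su; first lia.
  have [|t2' [u2 [E2 l2 su2 f2]]] := IH2 _ u1 su1; first exact: hm.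
  exists (t1' + t2').+1, u2; split=> //; [|lia|exact: framed_trans f1 f2].
  by apply: ExecWhileTrue E1 E2; rewrite (sim_reg su) //; lia.
- move=> x p s hx /= hm u su; exists 1, u; split=> //.
  by apply: ExecWhileFalse; rewrite (sim_reg su) //; lia.
Qed.

Fixpoint clear_registers (n : nat) : program :=
  if n is n'.+1 then Seq (clear_registers n') (Const (nvars + n') 0) else Skip.

Lemma exec_clear_registers n s : exists s',
  [/\ exec w (clear_registers n) s n.+1 s',
      forall y, y < n -> reg s' (nvars + y) = 0,
      forall y, y < nvars -> reg s' y = reg s y & memory s' = memory s].
Proof.
elim: n => [|n [s1 [E z f M]]]; first by exists s; split=> //; apply: ExecSkip.
exists (set_reg s1 (nvars + n) 0); split=> //.
- rewrite -[n.+2]addn1; apply: ExecSeq E _.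
  rewrite -[X in set_reg _ _ X](mod0n (2 ^ w)); exact: ExecConst.
- move=> y yn; rewrite /= /update eqn_add2l; case: eqP => // ny.
  by apply: z; lia.
- move=> y yn; rewrite /= /update ifF; first exact: f.
  by apply/eqP; lia.
Qed.

End Simulation.

Definition call (p : program) : program :=
  let m := (reg_bound p).+1 in
  Seq (clear_registers m)
    (Seq (simulate m p) (If nvars (Const (var_reg Found) 1) Skip)).

Lemma triple_call (P : problem) (p : program) (c : nat) (T : nat -> nat)
    (x : instance P) (w w' B : nat) (v0 : env) (m0 : nat -> nat) :
  decides_within P p c T -> word_length_ok c (input_size x) (encode x) w' ->
  w' <= w -> 0 < w -> B + 2 ^ w' <= 2 ^ w ->
  triple w
    (fun v m => [/\ v = v0, m = m0, modulus v = 2 ^ w', offset v = B &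
       forall a, a < 2 ^ w' -> m (B + a) = nth 0 (encode x) a])
    (call p) (2 * T (input_size x) + reg_bound p + 5)
    (fun v m =>
       [/\ exists2 b : bool, (b <-> yes_instance x) &
             v = if b then set v0 Found 1 else v0,
           forall a, ~~ (B <= a < B + 2 ^ w') -> m a = m0 a &
           forall a, B <= a < B + 2 ^ w' -> m a < 2 ^ w']).
Proof.
move=> hP ok ww w0 hB s [ev em hM hO hm].
have [t [s1 [E1 lt1 yes]]] := hP x w' ok.
case/and3P: (ok) => _ hsz /allP hall.
have M0 : 0 < 2 ^ w' by rewrite expn_gt0.
have [u1 [E2 z1 f1 m1]] := exec_clear_registers w (reg_bound p).+1 s.
have su : simulates w' B (reg_bound p).+1 (init_state (encode x)) u1.
  split=> //=.
  - by move=> a ha; rewrite m1 hm.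
  - move=> a; case: (ltnP a (size (encode x))) => ha.
      by apply: hall; apply: mem_nth.
    by rewrite nth_default.
  - by rewrite f1.
  - by rewrite f1.
have [t2 [u2 [E3 l3 su2 [fr fm]]]] :=
  exec_simulate ww hB E1 (leqnSn (reg_bound p)) su.
have hr0 : reg u2 nvars = reg s1 0 by rewrite -(sim_reg su2) ?addn0.
have e2 : env_of u2 = v0.
  by rewrite -ev; apply: env_of_eq => y yn; rewrite fr ?f1.
have hmem a : B <= a < B + 2 ^ w' -> memory u2 a < 2 ^ w'.
  move=> ha; have -> : a = B + (a - B) by lia.
  by rewrite (sim_mem su2); [exact: (sim_mem_lt su2) | lia].
have hfr a : ~~ (B <= a < B + 2 ^ w') -> memory u2 a = m0 a.
  by move=> ha; rewrite fm // m1 em.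
case: (eqVneq (reg s1 0) 0) => h0.
  exists ((reg_bound p).+2 + (t2 + 2)), u2; split=> //; [|lia|split=> //].
    apply: ExecSeq E2 _; apply: ExecSeq E3 _; apply: ExecIfFalse; first by rewrite hr0.
    exact: ExecSkip.
  by exists false => //; split=> // /yes; rewrite h0.
exists ((reg_bound p).+2 + (t2 + 2)); eexists; split; [|lia|split=> //].
- apply: ExecSeq E2 _; apply: ExecSeq E3 _; apply: ExecIfTrue; first by rewrite hr0.
  exact: ExecConst.
- exists true; first by split=> // _; apply/yes.
  rewrite (@env_of_set u2 _ Found) => [|y yn yx]; last by rewrite /= /update (negPf yx).
  rewrite e2 /= /update eqxx modn_small //.
  by rewrite -[1](expn0 2) ltn_exp2l.
- exact: hfr.
- exact: hmem.
Qed.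

(** * Cliques and progressions *)

Definition has_nat_AP (k : nat) (al : nat -> bool) : Prop :=
  exists x d : nat, 0 < d /\ forall i, i < k -> al (x + i * d).

Section DigitDecomposition.
Local Open Scope ring_scope.

Lemma digit_step (r j l : nat) (xi delta : int) : (0 < r)%N ->
  coprimez (l%:Z - j%:Z) r -> exists a b : nat, exists xi' delta' : int,
  [/\ (a < r)%N, (b < r)%N, delta = a%:Z + b%:Z + r%:Z * delta'
    & xi + j%:Z * a%:Z + l%:Z * b%:Z = r%:Z * xi'].
Proof.
move=> r0 /eqP cop; have [p [q E]] := Bezoutz (l%:Z - j%:Z) r.
rewrite cop in E.
have rz : r%:Z != 0 by apply/eqP; lia.
set y := - xi - j%:Z * delta.
have [B BE] : exists B : nat, ((p * y) %% r%:Z)%Z = B.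
  by case: ((p * y) %% r%:Z)%Z (modz_ge0 (p * y) rz) => // B _; exists B.
have [C CE] : exists C : nat, ((delta - B%:Z) %% r%:Z)%Z = C.
  by case: ((delta - B%:Z) %% r%:Z)%Z (modz_ge0 (delta - B%:Z) rz) => // C _; exists C.
have Blt : (B < r)%N by have := ltz_pmod (p * y) (d := r%:Z); rewrite BE; lia.
have Clt : (C < r)%N.
  by have := ltz_pmod (delta - B%:Z) (d := r%:Z); rewrite CE; lia.
have dB := divz_eq (p * y) r%:Z; rewrite BE in dB.
have dC := divz_eq (delta - B%:Z) r%:Z; rewrite CE in dC.
set g := (p * y %/ r%:Z)%Z in dB; set e := ((delta - B%:Z) %/ r%:Z)%Z in dC.
exists C, B, (- j%:Z * e - q * y - (l%:Z - j%:Z) * g), e; split=> //.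
  by rewrite -[LHS](subrK B%:Z) dC; ring.
have -> : C%:Z = delta - B%:Z - e * r%:Z by rewrite dC; ring.
have -> : B%:Z = p * y - g * r%:Z by rewrite dB; ring.
have -> : xi = - y - j%:Z * delta by rewrite /y; ring.
have E' : q * r%:Z = 1 - p * (l%:Z - j%:Z) by rewrite -E; ring.
transitivity (- y + (l%:Z - j%:Z) * p * y - (l%:Z - j%:Z) * g * r%:Z
  - j%:Z * e * r%:Z); first by ring.
have -> : r%:Z * (- j%:Z * e - q * y - (l%:Z - j%:Z) * g)
  = - (q * r%:Z) * y - (l%:Z - j%:Z) * g * r%:Z - j%:Z * e * r%:Z by ring.
by rewrite E'; ring.
Qed.

Lemma digit_expansion (r : nat) (sg : nat -> nat) (m : nat) (x d : nat) :
  (0 < r)%N -> (forall j, (j < m)%N -> coprimez ((sg j)%:Z - j%:Z) r) ->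
  exists s t : nat -> nat, exists xi delta : int,
  [/\ forall j, (s j < r)%N && (t j < r)%N,
      d%:Z = (\sum_(j < m) r ^ j * (s j + t j))%N%:Z + (r ^ m)%N%:Z * delta
    & (x + \sum_(j < m) r ^ j * (j * s j + sg j * t j))%N%:Z
      = (r ^ m)%N%:Z * xi].
Proof.
move=> r0; elim: m => [|m IH] cop.
  exists (fun _ => 0%N), (fun _ => 0%N), x%:Z, d%:Z.
  by rewrite !big_ord0 addn0 expn0 !mul1r add0r; split=> // j; rewrite r0.
have [|s [t [xi [delta [hst hd hx]]]]] := IH.
  by move=> j jm; apply: cop; apply: ltnW.
have [a [b [xi' [delta' [ar br hd' hx']]]]] :=
  digit_step xi delta r0 (cop m (ltnSn m)).
exists (fun j => if j == m then a else s j),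
  (fun j => if j == m then b else t j), xi', delta'; split.
- by move=> j; case: eqP => _ //; rewrite ar br.
- rewrite big_ord_recr /= eqxx (eq_bigr (fun j : 'I_m => r ^ j * (s j + t j))%N).
    by rewrite hd hd' !PoszD !PoszM expnSr PoszM PoszD; ring.
  by move=> j _; rewrite ltn_eqF.
- rewrite big_ord_recr /= eqxx
    (eq_bigr (fun j : 'I_m => r ^ j * (j * s j + sg j * t j))%N).
    rewrite addnA PoszD hx !PoszM !PoszD !PoszM expnSr PoszM -mulrA -hx'.
    by ring.
  by move=> j _; rewrite ltn_eqF.
Qed.

End DigitDecomposition.

Section Construction.
Variables (k r : nat) (al : nat -> bool) (X0 D0 : nat).
Let h := k.-1.
Let n := k * (r * r).

Definition part (v : nat) : nat := v %/ (r * r).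

(* A vertex is a part [i < k] together with two digits [s, t < r]; it stands
   for the integer [s r ^ i + t r ^ (i - 1 mod k)]. *)
Definition value (v : nat) : nat :=
  \sum_(i < k) (part v == i) *
    (v %/ r %% r * r ^ i + v %% r * r ^ ((i + k).-1 %% k)).

Definition hits (a b : nat) : bool := (b <= a) && al (a - b).

Definition edge_pred (I : finType) (e : {pred I}) (g : I -> nat) : bool :=
  [forall i : 'I_k, \sum_(v in e) (part (g v) == i) < 2] &&
  [exists i : 'I_k, (\sum_(v in e) (part (g v) == i) == 0) &&
    hits (X0 + i * D0 + \sum_(v in e) (i - part (g v)) * value (g v))
         (\sum_(v in e) (part (g v) - i) * value (g v))].

Definition AP_edges : {set {set 'I_n}} :=
  [set e : {set 'I_n} | (#|e| == h) && edge_pred (mem e) (@nat_of_ord n)].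

Lemma AP_edges_uniform e : e \in AP_edges -> #|e| = h.
Proof. by rewrite inE => /andP[/eqP]. Qed.

Definition AP_hypergraph : hypergraph h :=
  Hypergraph AP_edges_uniform.

Definition digit (j l : nat) : nat := j %/ n ^ l %% n.

Hypothesis r0 : 0 < r.
Hypothesis k3 : 2 < k.

Let n0 : 0 < n. Proof. by rewrite !muln_gt0 r0; lia. Qed.

Lemma part_lt (v : 'I_n) : part v < k.
Proof. by rewrite /part ltn_divLR ?muln_gt0 ?r0 //; case: v. Qed.

Lemma edge_pred_imset (I J : finType) (e : {set I}) (f : I -> J) (g : J -> nat) :
  {in e &, injective f} ->
  edge_pred (mem (f @: e)) g = edge_pred (mem e) (g \o f).
Proof.
move=> fi; have S F : \sum_(v in f @: e) F v = \sum_(v in e) F (f v).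
  exact: big_imset.
by rewrite /edge_pred; congr (_ && _);
  [apply: eq_forallb | apply: eq_existsb] => i; rewrite !S.
Qed.

Lemma digit_set_edge j :
  (digit_set n h j \in AP_edges) =
  edge_pred (mem [set: 'I_h]) (fun l : 'I_h => digit j l).
Proof.
pose g (l : 'I_h) : 'I_n := Ordinal (ltn_pmod (j %/ n ^ l) n0).
have E : digit_set n h j = g @: [set: 'I_h].
  apply/setP => v; rewrite inE; apply/existsP/imsetP => [[l /eqP vl]|[l _ ->]].
    by exists l => //; apply: val_inj.
  by exists l.
rewrite inE; case: (boolP (injectiveb g)) => [/injectiveP gi | /injectivePn].
  rewrite E card_imset // cardsT card_ord eqxx /= edge_pred_imset //.
  by move=> x y _ _; apply: gi.
move=> [l1 [l2 l12 gl]].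
have -> : (#|digit_set n h j| == h) = false.
  rewrite E; apply: ltn_eqF; rewrite ltn_neqAle.
  have := leq_imset_card g [set: 'I_h]; rewrite cardsT card_ord => ->.
  rewrite andbT; apply/negP => /eqP c.
  have /imset_injP gi : #|g @: [set: 'I_h]| == #|[set: 'I_h]|.
    by rewrite c cardsT card_ord.
  by move: l12; rewrite (gi l1 l2) ?inE // eqxx.
apply/esym/negbTE; rewrite negb_and; apply/orP; left; rewrite negb_forall.
apply/existsP; exists (Ordinal (part_lt (g l1))) => /=.
rewrite (bigD1 l1) ?inE //= (bigD1 l2) /=; last by rewrite inE eq_sym.
have -> : digit j l2 = digit j l1 by case: gl.
by rewrite eqxx -leqNgt addnA leq_addr.
Qed.

Lemma hits_AP (I : finType) (e : {pred I}) (g : I -> nat) :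
  (forall i, i < k ->
    hits (X0 + i * D0 + \sum_(v in e) (i - part (g v)) * value (g v))
         (\sum_(v in e) (part (g v) - i) * value (g v))) ->
  exists x, forall i, i < k -> al (x + i * (D0 + \sum_(v in e) value (g v))).
Proof.
move=> H.
set P := \sum_(v in e) part (g v) * value (g v).
have E i : \sum_(v in e) (i - part (g v)) * value (g v) + P =
   i * \sum_(v in e) value (g v) + \sum_(v in e) (part (g v) - i) * value (g v).
  rewrite /P big_distrr -!big_split; apply: eq_bigr => v _ /=; nia.
have := H 0 ltac:(lia); rewrite {1}/hits => /andP[+ _].
rewrite mul0n addn0 [X in _ <= _ + X]big1 => [|v _]; last by rewrite sub0n.
rewrite addn0 (eq_bigr (fun v => part (g v) * value (g v))); last first.
  by move=> v _; rewrite subn0.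
rewrite -/P => leP; exists (X0 - P) => i ik.
have /andP[le ] := H i ik; congr (al _); have := E i.
by rewrite mulnDr; move: le; lia.
Qed.

Lemma AP_of_clique : 0 < D0 -> has_clique k AP_hypergraph -> has_nat_AP k al.
Proof.
move=> D1 [K0 cK0 hK0].
have [K [cK hK]] : exists K : {set 'I_n}, #|K| = k /\
    forall e : {set 'I_n}, e \subset K -> #|e| = h -> e \in AP_edges.
  by exists K0.
have edge y : y \in K -> edge_pred (mem (K :\ y)) (@nat_of_ord n).
  move=> yK; have : K :\ y \in AP_edges.
    apply: hK; first exact: subD1set.
    by move: (cardsD1 y K); rewrite yK cK /h; lia.
  by rewrite inE => /andP[].
pose pt (v : 'I_n) : 'I_k := Ordinal (part_lt v).
have pinj : {in K &, injective pt}.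
  move=> z z' zK z'K pz; apply/eqP/negPn/negP => zz'.
  have [y yK] : exists y, y \in K :\ z :\ z'.
    apply/set0Pn; rewrite -card_gt0.
    move: (cardsD1 z K) (cardsD1 z' (K :\ z)); rewrite zK cK !inE z'K eq_sym zz' /=.
    by lia.
  move: yK; rewrite !inE => /and3P[yz' yz yK].
  have /andP[/forallP/(_ (pt z)) + _] := edge y yK.
  rewrite (bigD1 z) /=; last by rewrite !inE eq_sym yz.
  rewrite (bigD1 z') /=; last by rewrite !inE eq_sym yz' z'K eq_sym zz'.
  have -> : part z' = part z by case: pz.
  by rewrite eqxx addnA ltnNge leq_addr.
have psurj i : exists2 z, z \in K & pt z = i.
  have : pt @: K == [set: 'I_k].
    by rewrite eqEcard finset.subsetT cardsT card_ord card_in_imset // cK leqnn.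
  by move/eqP/setP/(_ i); rewrite inE => /imsetP[z zK ->]; exists z.
have [|x hx] := @hits_AP _ (mem K) (@nat_of_ord n).
  move=> i0 i0k; have [z zK pz] := psurj (Ordinal i0k).
  have /andP[_ /existsP[i /andP[/eqP ci hi]]] := edge z zK.
  have ei : i = Ordinal i0k.
    apply/eqP/negPn/negP => ne; have [z' z'K pz'] := psurj i.
    move: ci; rewrite (bigD1 z') /=; last first.
      by rewrite !inE z'K andbT; apply/eqP => E; move: ne; rewrite -pz' E pz eqxx.
    have -> : part z' = i by rewrite -pz'.
    by rewrite eqxx.
  have pz' : part z = i0 by case: pz.
  move: hi; rewrite ei /= => hi; congr (hits (_ + _) _): hi.
  - rewrite [RHS](bigD1 z) //= pz' subnn mul0n add0n.
    by apply: eq_bigl => v; rewrite !inE andbC.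
  - rewrite [RHS](bigD1 z) //= pz' subnn mul0n add0n.
    by apply: eq_bigl => v; rewrite !inE andbC.
by exists x, (D0 + \sum_(v in K) value v); split=> //; lia.
Qed.

Lemma edge_pred_del (K : {set 'I_n}) (z : 'I_n) :
  {in K &, injective (fun v : 'I_n => part v)} -> z \in K ->
  hits (X0 + part z * D0 + \sum_(v in K) (part z - part v) * value v)
       (\sum_(v in K) (part v - part z) * value v) ->
  edge_pred (mem (K :\ z)) (@nat_of_ord n).
Proof.
move=> pinj zK hz; apply/andP; split.
  apply/forallP => i; case: (pickP [pred v : 'I_n | (v \in K :\ z) && (part v == i)]) => /= [v|no].
    rewrite in_setD1 => /andP[/andP[vz vK] vi].
    rewrite (bigD1 v) /=; last by rewrite in_setD1 vz.
    rewrite vi big1 // => v' /andP[]; rewrite in_setD1 => /andP[_ v'K] vv'.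
    apply/eqP; rewrite eqb0; apply: contra vv' => /eqP v'i.
    by apply/eqP; apply: pinj => //; rewrite v'i (eqP vi).
  rewrite big1 // => v vK; apply/eqP; rewrite eqb0; apply/negP => vi.
  by have /negP := no v; apply; apply/andP.
apply/existsP; exists (Ordinal (part_lt z)); apply/andP; split=> /=.
  rewrite sum_nat_eq0; apply/forall_inP => v; rewrite in_setD1 => /andP[vz vK].
  by rewrite eqb0; apply: contra vz => /eqP E; apply/eqP/pinj.
congr (hits (_ + _) _): hz; rewrite (bigD1 z) //= subnn mul0n add0n;
  by apply: eq_bigl => v; rewrite !inE andbC.
Qed.

Lemma clique_of_AP (s t : nat -> nat) (x : nat) :
  (forall j, (s j < r) && (t j < r)) ->
  let f i := s i * r ^ i + t i * r ^ ((i + k).-1 %% k) in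
  X0 = x + \sum_(i < k) i * f i ->
  (forall i, i < k -> al (x + i * (D0 + \sum_(i < k) f i))) ->
  has_clique k AP_hypergraph.
Proof.
move=> st f X0E hal.
have vlt (i : 'I_k) : i * (r * r) + (s i * r + t i) < n.
  have /andP[hs ht] := st i; have ik := ltn_ord i; rewrite /n.
  apply: (@leq_trans (i.+1 * (r * r))); last by rewrite leq_mul2r ik orbT.
  rewrite mulSn; nia.
pose vert (i : 'I_k) : 'I_n := Ordinal (vlt i).
have pv i : part (vert i) = i.
  have /andP[hs ht] := st i.
  rewrite /part /= divnMDl ?muln_gt0 ?r0 // divn_small ?addn0 //; nia.
have vv i : value (vert i) = f i.
  rewrite /value (bigD1 i) // pv eqxx mul1n big1 ?addn0; last first.
    by move=> j ji; rewrite eq_sym (inj_eq val_inj) (negPf ji).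
  have /andP[hs ht] := st i.
  have -> : vert i = (i * r + s i) * r + t i :> nat by rewrite /= mulnA addnA -mulnDl.
  rewrite divnMDl // (divn_small ht) addn0 !modnMDl (modn_small hs) (modn_small ht).
  exact: addn0.
have vinj : injective vert.
  by move=> i j E; apply: val_inj; move: (pv i); rewrite E pv.
pose K := vert @: [set: 'I_k].
have sumK F : \sum_(v in K) F v = \sum_(i < k) F (vert i).
  rewrite big_imset /=; last by move=> i j _ _; apply: vinj.
  by apply: eq_bigl => i; rewrite inE.
have cK : #|K| = k by rewrite card_imset // cardsT card_ord.
suff hK (e : {set 'I_n}) : e \subset K -> #|e| = h -> e \in AP_edges by exists K.
move=> eK ce.
have [z zK ez] : exists2 z, z \in K & e = K :\ z.
  have : #|K :\: e| == 1.
    by move: (cardsID e K); rewrite (finset.setIidPr eK) cK ce /h => E; apply/eqP; apply: (@addnI k.-1); rewrite E; lia.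
  case/finset.cards1P => z E; exists z.
    by move/setP/(_ z): E; rewrite !inE eqxx => /andP[].
  apply/setP => v; move/setP/(_ v): E; rewrite !inE; case: eqP => /= _.
    by move/andP => [/negPf ->].
  by case: (boolP (v \in e)) => [/(fintype.subsetP eK) -> | _ /= ->].
rewrite inE ce eqxx ez edge_pred_del //.
  by move=> _ _ /imsetP[i _ ->] /imsetP[j _ ->]; rewrite !pv => /val_inj ->.
case/imsetP: zK => i0 _ ->; rewrite pv !sumK.
rewrite (eq_bigr (fun i : 'I_k => (i0 - i) * f i)) => [|i _]; last by rewrite pv vv.
rewrite [X in hits _ X](eq_bigr (fun i : 'I_k => (i - i0) * f i)) => [|i _]; last by rewrite pv vv.
have E : X0 + i0 * D0 + \sum_(i < k) (i0 - i) * f i =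
  x + i0 * (D0 + \sum_(i < k) f i) + \sum_(i < k) (i - i0) * f i.
  rewrite X0E mulnDr [i0 * \sum_(i < k) _]big_distrr -!addnA; congr addn.
  rewrite addnCA; congr addn; rewrite -!big_split; apply: eq_bigr => i _ /=.
  nia.
by rewrite /hits E leq_addl addnK; apply: hal.
Qed.

End Construction.

Lemma AP_covered (k r : nat) (al : nat -> bool) (x d : nat) :
  0 < r -> 2 < k -> coprime k.-1 r -> 2 * r ^ k <= d ->
  (forall i, i < k -> al (x + i * d)) ->
  exists u v : nat, [/\ 0 < v, r ^ k * v <= d, r ^ k * u <= x + 2 * k * r ^ k
    & has_clique k (AP_hypergraph k r al (r ^ k * u) (r ^ k * v))].
Proof.
move=> r0 k3 cop dL hal; have k0 : 0 < k by lia.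
pose sg j := j.+1 %% k.
have csg j : j < k -> coprimez ((sg j)%:Z - j%:Z)%R r.
  move=> jk; rewrite /sg; case: (ltnP j.+1 k) => jk'.
    rewrite modn_small //; have -> : (j.+1%:Z - j%:Z = 1)%R by lia.
    by rewrite coprimezE coprime1n.
  have -> : j.+1 = k by lia.
  rewrite modnn; have -> : (0%:Z - j%:Z = - k.-1%:Z)%R by lia.
  by rewrite coprimeNz.
have [s [t [xi [delta [st hd hx]]]]] := digit_expansion x d r0 csg.
pose t' i := t ((i + k).-1 %% k).
pose f i := s i * r ^ i + t' i * r ^ ((i + k).-1 %% k).
have Sf : \sum_(i < k) f i = \sum_(j < k) r ^ j * (s j + t j).
  rewrite big_split /= [X in _ + X](_ : _ = \sum_(j < k) t j * r ^ j).
    by rewrite -big_split; apply: eq_bigr => j _ /=; ring.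
  by rewrite [RHS](reindex_inj (can_inj (@ord_predK k))).
have Pf : \sum_(i < k) i * f i = \sum_(j < k) r ^ j * (j * s j + sg j * t j).
  rewrite (eq_bigr (fun i : 'I_k => i * (s i * r ^ i) +
     sg ((i + k).-1 %% k) * (t' i * r ^ ((i + k).-1 %% k)))); last first.
    move=> i _; have -> : sg ((i + k).-1 %% k) = i := congr1 val (ord_predK i).
    by rewrite -mulnDr.
  rewrite big_split /= [X in _ + X](_ : _ = \sum_(j < k) sg j * (t j * r ^ j)).
    by rewrite -big_split; apply: eq_bigr => j _ /=; ring.
  by rewrite [RHS](reindex_inj (can_inj (@ord_predK k))).
rewrite -Sf in hd; rewrite -Pf in hx.
have Slt : \sum_(i < k) f i < 2 * r ^ k.
  have arith S R a b : S + 2 <= 2 * R -> a < r -> b < r ->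
      S + R * (a + b) + 2 <= 2 * (r * R).
    move=> hS ha hb; have : R * (a + b + 2) <= R * (2 * r).
      by rewrite leq_mul2l; apply/orP; right; lia.
    nia.
  rewrite Sf; have : forall m, \sum_(j < m) r ^ j * (s j + t j) + 2 <= 2 * r ^ m.
    elim=> [|m IH]; first by rewrite big_ord0.
    rewrite big_ord_recr /= expnS; have /andP[hs ht] := st m.
    exact: arith.
  by move/(_ k); lia.
have Ple : \sum_(i < k) i * f i <= k * \sum_(i < k) f i.
  rewrite big_distrr; apply: leq_sum => i _ /=.
  by rewrite leq_mul2r ltnW ?orbT.
have L0 : 0 < r ^ k by rewrite expn_gt0 r0.
have [v vE] : exists v : nat, delta = v.
  by case: delta hd => [v|v] hd; [exists v | exfalso; move: hd; nia].
have [u uE] : exists u : nat, xi = u.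
  by case: xi hx => [u|u] hx; [exists u | exfalso; move: hx; nia].
have {}hd : d = \sum_(i < k) f i + r ^ k * v by move: hd; rewrite vE; lia.
have {}hx : x + \sum_(i < k) i * f i = r ^ k * u by move: hx; rewrite uE; lia.
exists u, v; split.
- by rewrite lt0n; apply/eqP => v0; move: hd; rewrite v0; lia.
- lia.
- by rewrite -hx -mulnA; nia.
- apply: (@clique_of_AP _ _ _ _ _ r0 k3 s t' x); first by move=> j; rewrite /t'; have /andP[-> _] := st j; have /andP[_ ->] := st ((j + k).-1 %% k).
  + by rewrite -hx.
  + by move=> i ik; rewrite [r ^ k * v + _]addnC -hd; apply: hal.
Qed.

(** * Expressions describing the instances *)

Fixpoint epow (e : expr) (n : nat) : expr :=
  if n is n'.+1 then Op Mul e (epow e n') else Num 1.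

Fixpoint esum (n : nat) (f : nat -> expr) : expr :=
  if n is n'.+1 then Op Add (esum n' f) (f n') else Num 0.

Fixpoint eprod (n : nat) (f : nat -> expr) : expr :=
  if n is n'.+1 then Op Mul (eprod n' f) (f n') else Num 1.

Lemma den_epow v m e n : den v m (epow e n) = den v m e ^ n.
Proof. by elim: n => //= n ->; rewrite expnS. Qed.

Lemma den_esum v m n f : den v m (esum n f) = \sum_(i < n) den v m (f i).
Proof. by elim: n => [|n IH] /=; rewrite ?big_ord0 // big_ord_recr IH. Qed.

Lemma den_eprod v m n f : den v m (eprod n f) = \prod_(i < n) den v m (f i).
Proof. by elim: n => [|n IH] /=; rewrite ?big_ord0 // big_ord_recr IH. Qed.

Lemma prod_nat_of_bool n (b : 'I_n -> bool) :
  \prod_(i < n) b i = [forall i, b i] :> nat.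
Proof.
case: (boolP [forall i, b i]) => [/forallP h | /forallPn[i /negPf h]].
  by rewrite big1 // => i _; rewrite h.
by rewrite (bigD1 i) //= h.
Qed.

Lemma sum_nat_of_bool_gt0 n (b : 'I_n -> bool) :
  (0 < \sum_(i < n) b i) = [exists i, b i].
Proof.
rewrite lt0n sum_nat_eq0 negb_forall_in; apply: eq_existsb => i.
by rewrite eqb0 negbK.
Qed.

Section Program.
Variable k : nat.
Let h := k.-1.

Definition e_side := epow (Var Base) k.
Definition e_vertices := Op Mul (Num k) (Op Mul (Var Base) (Var Base)).
Definition e_bit e :=
  Op Mul (Op Lt e (Op Add (Var Size) (Num 1))) (Mem (Op Add e (Num 1))).
Definition e_below := Op Lt (epow (Var Base) (2 * k)) (Op Add (Var Size) (Num 1)).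
Definition e_rows := Op Add (Op Div (Var Size) e_side) (Num (2 * k).+1).
Definition e_cols := Op Add (Op Div (Var Size) e_side) (Num 1).
Definition e_X0 := Op Mul e_side (Op Div (Var Outer) e_cols).
Definition e_D0 :=
  Op Mul e_side (Op Add (Op Mod (Var Outer) e_cols) (Num 1)).
Definition e_digit l := Op Mod (Op Div (Var Inner) (epow e_vertices l)) e_vertices.
Definition e_part l := Op Div (e_digit l) (Op Mul (Var Base) (Var Base)).
Definition e_value l :=
  esum k (fun i => Op Mul (Op Eq (e_part l) (Num i))
    (Op Add
      (Op Mul (Op Mod (Op Div (e_digit l) (Var Base)) (Var Base)) (epow (Var Base) i))
      (Op Mul (Op Mod (e_digit l) (Var Base)) (epow (Var Base) ((i + k).-1 %% k))))).
Definition e_count i := esum h (fun l => Op Eq (e_part l) (Num i)).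
Definition e_pos i :=
  Op Add (Op Add e_X0 (Op Mul (Num i) e_D0))
    (esum h (fun l => Op Mul (Op Sub (Num i) (e_part l)) (e_value l))).
Definition e_neg i :=
  esum h (fun l => Op Mul (Op Sub (e_part l) (Num i)) (e_value l)).
Definition e_hits i :=
  Op Mul (Op Lt (e_neg i) (Op Add (e_pos i) (Num 1)))
    (e_bit (Op Sub (e_pos i) (e_neg i))).
Definition e_adjacent :=
  Op Mul (eprod k (fun i => Op Lt (e_count i) (Num 2)))
    (Op Lt (Num 0) (esum k (fun i =>
      Op Mul (Op Eq (e_count i) (Num 0)) (e_hits i)))).
Definition e_diff :=
  Op Add (Op Div (Var Outer) (Op Add (Var Size) (Num 1))) (Num 1).
Definition e_start := Op Mod (Var Outer) (Op Add (Var Size) (Num 1)).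
Definition e_progression :=
  eprod k (fun i => e_bit (Op Add e_start (Op Mul (Num i) e_diff))).

Definition rows (N r : nat) := N %/ r ^ k + (2 * k).+1.
Definition cols (N r : nat) := N %/ r ^ k + 1.

Definition bits_in_memory (N : nat) (al : nat -> bool) (m : nat -> nat) : Prop :=
  forall a, a < N.+1 -> m a.+1 = al a.

Lemma den_e_bit v m al e :
  bits_in_memory (size_ v) al m -> (forall a, al a -> a < (size_ v).+1) ->
  den v m (e_bit e) = al (den v m e).
Proof.
move=> hm hal; rewrite /= !addn1; case: ltnP => h1; first by rewrite hm // mul1n.
by rewrite mul0n; case: (boolP (al _)) => // /hal; rewrite ltnNge h1.
Qed.

Definition shifted (r : nat) (al : nat -> bool) (N q : nat) :=
  AP_hypergraph k r al (r ^ k * (q %/ cols N r)) (r ^ k * (q %% cols N r + 1)).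

Lemma den_e_part v m l :
  den v m (e_part l) = part (base v) (digit k (base v) (inner v) l).
Proof. by rewrite /e_part /e_digit /= den_epow. Qed.

Lemma den_e_value v m l :
  den v m (e_value l) = value k (base v) (digit k (base v) (inner v) l).
Proof.
rewrite /e_value den_esum; apply: eq_bigr => i _.
by rewrite [LHS]/= -!/(den v m _) !den_epow.
Qed.

Lemma den_e_count v m i : den v m (e_count i) =
  \sum_(l in [set: 'I_h]) (part (base v) (digit k (base v) (inner v) l) == i).
Proof.
rewrite /e_count den_esum; apply: eq_big => [l|l _]; first by rewrite inE.
by rewrite -(den_e_part v m).
Qed.

Lemma den_e_adjacent v m al :
  bits_in_memory (size_ v) al m -> (forall a, al a -> a < (size_ v).+1) ->
  den v m e_adjacent =
  edge_pred k (base v) al (base v ^ k * (outer v %/ cols (size_ v) (base v)))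
    (base v ^ k * (outer v %% cols (size_ v) (base v) + 1))
    (mem [set: 'I_h]) (fun l : 'I_h => digit k (base v) (inner v) l).
Proof.
move=> hm hal; have -> : den v m e_adjacent =
    den v m (eprod k (fun i => Op Lt (e_count i) (Num 2))) *
    (0 < den v m (esum k (fun i =>
      Op Mul (Op Eq (e_count i) (Num 0)) (e_hits i)))) by [].
rewrite den_eprod den_esum /edge_pred.
rewrite (eq_bigr (fun i : 'I_k =>
  nat_of_bool (\sum_(l in [set: 'I_h])
    (part (base v) (digit k (base v) (inner v) l) == i) < 2))); last first.
  by move=> i _; rewrite -(den_e_count v m).
rewrite prod_nat_of_bool -mulnb; congr (_ * nat_of_bool _).
rewrite -sum_nat_of_bool_gt0; congr (0 < _); apply: eq_bigr => i _.
rewrite -(den_e_count v m).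
have -> : \sum_(l in [set: 'I_h]) (i - part (base v) (digit k (base v) (inner v) l)) *
     value k (base v) (digit k (base v) (inner v) l) =
   den v m (esum h (fun l => Op Mul (Op Sub (Num i) (e_part l)) (e_value l))).
  rewrite den_esum; apply: eq_big => [l|l _]; first by rewrite inE.
  by rewrite -(den_e_value v m) -(den_e_part v m).
have -> : \sum_(l in [set: 'I_h]) (part (base v) (digit k (base v) (inner v) l) - i) *
     value k (base v) (digit k (base v) (inner v) l) = den v m (e_neg i).
  rewrite /e_neg den_esum; apply: eq_big => [l|l _]; first by rewrite inE.
  by rewrite -(den_e_value v m) -(den_e_part v m).
set s := esum _ _.
rewrite -mulnb.
have -> : den v m (Op Mul (Op Eq (e_count i) (Num 0)) (e_hits i)) =
  (den v m (e_count i) == 0) * den v m (e_hits i) by [].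
congr (_ * _).
have -> : den v m (e_hits i) = (den v m (e_neg i) < den v m (e_pos i) + 1) *
   den v m (e_bit (Op Sub (e_pos i) (e_neg i))) by [].
rewrite (den_e_bit _ hm hal) /hits -mulnb addn1 ltnS.
have -> : base v ^ k * (outer v %/ cols (size_ v) (base v)) +
  i * (base v ^ k * (outer v %% cols (size_ v) (base v) + 1)) + den v m s =
  den v m (e_pos i); last by [].
by rewrite /e_pos /= !den_epow.
Qed.

Definition progression (N : nat) (al : nat -> bool) (j : nat) : bool :=
  [forall i : 'I_k, al (j %% N.+1 + i * (j %/ N.+1 + 1))].

Lemma den_e_progression v m al :
  bits_in_memory (size_ v) al m -> (forall a, al a -> a < (size_ v).+1) ->
  den v m e_progression = progression (size_ v) al (outer v).
Proof.
move=> hm hal; rewrite /e_progression den_eprod.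
rewrite (eq_bigr (fun i : 'I_k =>
   nat_of_bool (al (outer v %% (size_ v).+1 + i * (outer v %/ (size_ v).+1 + 1))))).
  exact: prod_nat_of_bool.
by move=> i _; rewrite (den_e_bit _ hm hal) /= addn1.
Qed.

Lemma bounded_search (N r : nat) (al : nat -> bool) :
  0 < r -> 2 < k -> coprime h r -> (forall a, al a -> a < N.+1) ->
  has_nat_AP k al <->
  (exists2 j, j < 2 * r ^ k * N.+1 & progression N al j) \/
  (exists2 q, q < rows N r * cols N r & has_clique k (shifted r al N q)).
Proof.
move=> r0 k3 cop hal; have L0 : 0 < r ^ k by rewrite expn_gt0 r0.
split=> [[x [d [d0 hx]]]|[[j _ /forallP hj]|[q _ hq]]]; last 2 first.
- exists (j %% N.+1), (j %/ N.+1 + 1); split=> [|i ik]; first by rewrite addn1.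
  exact: (hj (Ordinal ik)).
- by apply: AP_of_clique hq => //; rewrite muln_gt0 L0 addn1.
have xN := hal _ (hx 0 ltac:(lia)); rewrite addn0 in xN.
have dN := hal _ (hx 1 ltac:(lia)); rewrite mul1n in dN.
case: (ltnP d (2 * r ^ k)) => hd.
  left; exists (d.-1 * N.+1 + x); first by nia.
  apply/forallP => i; rewrite modnMDl divnMDl // modn_small // divn_small // addn0.
  by rewrite addn1 prednK //; apply: hx.
right; have [u [v [v0 vd ux hc]]] := AP_covered r0 k3 cop hd hx.
have V0 : 0 < cols N r by rewrite /cols addn1.
have vV : v.-1 < cols N r.
  have : v <= N %/ r ^ k by rewrite leq_divRL // mulnC; lia.
  by rewrite /cols; lia.
have uU : u < rows N r.
  have : u - 2 * k <= N %/ r ^ k.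
    by rewrite leq_divRL // mulnBl mulnC; lia.
  by rewrite /rows; lia.
exists (u * cols N r + v.-1); first by nia.
rewrite /shifted modnMDl divnMDl // modn_small // divn_small // addn0.
by rewrite addn1 prednK.
Qed.

Fixpoint digits_exponent (N i : nat) : nat :=
  if i is i'.+1 then
    let e := digits_exponent N i' in if (k ^ e) ^ (2 * k) < N.+1 then e.+1 else e
  else 0.

Definition exponent (N : nat) := digits_exponent N N.+1.

Lemma digits_exponent_le N i j : i <= j -> digits_exponent N i <= digits_exponent N j.
Proof.
move/subnKC <-; elim: (j - i) => [|d IH]; first by rewrite addn0.
by rewrite addnS /=; case: ifP => _ //; apply: leqW.
Qed.

Lemma exponent_gt N : 1 < k -> N < (k ^ exponent N) ^ (2 * k).
Proof.
move=> k1.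
have H i : N < (k ^ digits_exponent N i) ^ (2 * k) \/ digits_exponent N i = i.
  elim: i => [|i IH]; first by right.
  rewrite /=; case: (ltnP ((k ^ digits_exponent N i) ^ (2 * k)) N.+1) => hlt; last by left.
  case: IH => [hgt|->]; last by right.
  by move: hlt; rewrite ltnS leqNgt hgt.
case: (H N.+1) => // E; rewrite /exponent E.
have k0 : 0 < k by lia.
have kN : N.+1 < k ^ N.+1 := ltn_expl N.+1 k1.
apply: leq_trans (ltnW kN) _.
by rewrite -{1}(expn1 (k ^ N.+1)) leq_exp2l; lia.
Qed.

Lemma exponent_le N :
  exponent N = 0 \/ (k ^ (exponent N).-1) ^ (2 * k) <= N.
Proof.
rewrite /exponent; elim: N.+1 => [|i IH]; first by left.
by rewrite /=; case: ifP => // hlt; right; rewrite -ltnS.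
Qed.

End Program.

(** * The reduction *)

Section Reduction.
Variables (k c' : nat) (p : program) (T : nat -> nat).
Let h := k.-1.

Definition e_size_bound := Op Mul (Op Mul (Num 2) (e_side k)) (Op Add (Var Size) (Num 1)).
Definition e_calls := Op Mul (e_rows k) (e_cols k).
Definition e_entries := epow (e_vertices k) h.

(* The exponent in [Modulus = 2 ^ (log_modulus * (exponent k N).+1)]: large
   enough for [Modulus] to exceed all these quantities, by [den_le]. *)
Definition log_modulus : nat :=
  2 * k * k *
  (weight (Op Add (Var Size) (Num 2)) + weight e_size_bound
   + weight (Op Add e_calls (Num 1)) + weight (Op Add e_entries (Num 1))
   + weight (epow (Op Add (e_vertices k) (Num 2)) c')
   + weight (Op Add (e_vertices k) (Num 1))).

Definition e_new_modulus :=
  Op Mul (Var Modulus)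
    (Op Add (Num 1) (Op Mul (Num (2 ^ log_modulus).-1) (e_below k))).
Definition e_new_base :=
  Op Mul (Var Base) (Op Add (Num 1) (Op Mul (Num k.-1) (e_below k))).
Definition e_found := Op Lt (Num 0) (Op Add (Var Found) (e_progression k)).
Definition e_offset := Op Mul (Op Add (Var Outer) (Num 1)) (Var Modulus).
Definition e_address := Op Add (Var Offset) (Op Add (Var Inner) (Num 1)).

Definition setup : program :=
  Seq (assign Size (Mem (Num 0)))
    (Seq (assign Base (Num 1)) (assign Modulus (Num (2 ^ log_modulus)))).
Definition choose_base : program :=
  for_loop Outer (Op Add (Var Size) (Num 1))
    (Seq (assign Modulus e_new_modulus) (assign Base e_new_base)).
Definition search_small : program :=
  for_loop Outer e_size_bound (assign Found e_found).
Definition write_instance : program :=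
  for_loop Inner e_entries (store e_address (e_adjacent k)).
Definition search_large : program :=
  for_loop Outer e_calls
    (Seq (assign Offset e_offset) (Seq (store (Var Offset) (e_vertices k))
       (Seq write_instance (call p)))).
Definition reduction : program :=
  Seq setup (Seq choose_base (Seq search_small search_large)).

Definition max_weight : nat :=
  weight (Mem (Num 0)) + weight (Num (2 ^ log_modulus))
  + weight (Op Add (Var Size) (Num 1)) + weight e_new_modulus
  + weight e_new_base + weight e_size_bound + weight e_found
  + weight e_entries + weight e_address + weight (e_adjacent k)
  + weight e_calls + weight e_offset + weight (e_vertices k) + 3.

Hypothesis k3 : 2 < k.

Section Run.
Variables (N w : nat) (al : nat -> bool) (m0 : nat -> nat).

Let e := exponent k N.
Let r := k ^ e.
Let n := k * (r * r).
Let w' := log_modulus * e.+1.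
Let M := 2 ^ w'.
Let X := M ^ 2.

Lemma modulus_bounds :
  [/\ N.+2 <= M, 2 * r ^ k * N.+1 <= M, rows k N r * cols k N r < M,
      n ^ h < M & n.+2 ^ c' <= M /\ n < M].
Proof.
set b := 2 ^ e.+1; have b1 : 1 < b by rewrite -{1}(expn0 2) ltn_exp2l.
pose Y := b ^ (2 * k * k).
have hr : r <= b ^ k.
  rewrite /r /b -expnM mulnC expnM; apply: (@leq_trans ((2 ^ k) ^ e)).
    by case: (e) => // e'; rewrite leq_exp2r // ltnW // ltn_expl.
  by rewrite leq_exp2l // -{1}(expn0 2) ltn_exp2l //; lia.
have rY : r <= Y by apply: leq_trans hr _; rewrite leq_exp2l //; nia.
have NY : N.+1 <= Y.
  have k1 : 1 < k by lia.
  apply: leq_trans (exponent_gt N k1) _.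
  rewrite -/e -/r /Y [2 * k * k]mulnC [X in _ <= X]expnM; apply: (@leq_trans ((b ^ k) ^ (2 * k))).
    by rewrite leq_exp2r //; lia.
  by rewrite -!expnM leq_exp2l //; nia.
have Y1 : 1 < Y by rewrite /Y -{1}(exp1n (2 * k * k)) ltn_exp2r //; nia.
pose v := Env 0 N r 0 0 0 0.
have bY : bounded Y v (fun=> 0) by split=> // -[] //=; lia.
have H f : weight f <= log_modulus %/ (2 * k * k) -> den v (fun=> 0) f <= M.
  move=> hf; apply: leq_trans (den_le f Y1 bY) _.
  rewrite /M /w' mulnC expnM -/b /Y -expnM leq_exp2l //.
  apply: (@leq_trans (2 * k * k * (log_modulus %/ (2 * k * k)))).
    by rewrite leq_mul2l hf orbT.
  by rewrite mulnC leq_divM.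
move: H; rewrite /log_modulus mulKn; last nia.
move=> H; split.
- by have := H (Op Add (Var Size) (Num 2)) ltac:(lia); rewrite /= addn2.
- have := H e_size_bound ltac:(lia).
  by rewrite /e_size_bound /e_side /= den_epow addn1.
- have := H (Op Add e_calls (Num 1)) ltac:(lia).
  by rewrite /e_calls /e_rows /e_cols /e_side /= !den_epow addn1.
- have := H (Op Add e_entries (Num 1)) ltac:(lia).
  by rewrite /e_entries /= den_epow /= addn1.
- split.
    have := H (epow (Op Add (e_vertices k) (Num 2)) c') ltac:(lia).
    by rewrite den_epow /= addn2.
  have := H (Op Add (e_vertices k) (Num 1)) ltac:(lia).
  by rewrite /= addn1.
Qed.

Lemma modulus_le : M <= N.+2 ^ (3 * log_modulus).
Proof.
suff H : 2 ^ e.+1 <= N.+2 ^ 3.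
  rewrite /M /w' mulnC expnM [N.+2 ^ _]expnM.
  by case: log_modulus => // L; rewrite leq_exp2r.
case: (exponent_le k N) => [|hle]; rewrite -/e.
  by move=> ->; apply: (@leq_trans (2 ^ 3)); rewrite ?leq_exp2r.
case E : (e) => [|e']; first by apply: (@leq_trans (2 ^ 3)); rewrite ?leq_exp2r.
move: hle; rewrite -/e E /= => hle.
have : 2 ^ e' <= N.
  apply: leq_trans hle; apply: (@leq_trans (k ^ e')).
    by case: (e') => // e''; rewrite leq_exp2r //; lia.
  by rewrite -{1}(expn1 (k ^ e')) leq_pexp2l ?expn_gt0; lia.
by rewrite !expnS expn0; nia.
Qed.

Hypothesis hX : X ^ max_weight < 2 ^ w.
Hypothesis m0_size : m0 0 = N.
Hypothesis m0_bits : bits_in_memory N al m0.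
Hypothesis m0_tail : forall a, N.+1 < a -> m0 a = 0.
Hypothesis al_lt : forall a, al a -> a < N.+1.

Let k0 : 0 < k. Proof. lia. Qed.
Let r0 : 0 < r. Proof. by rewrite expn_gt0 k0. Qed.
Let M1 : 1 < M. Proof. by case: modulus_bounds => + _ _ _ _; lia. Qed.
Let MX : M <= X. Proof. by rewrite /X -{1}(expn1 M) leq_exp2l. Qed.
Let X1 : 1 < X. Proof. exact: leq_trans M1 MX. Qed.
Let rM : r <= M.
Proof.
case: modulus_bounds => _ _ _ _ [_ nM]; apply: leq_trans (ltnW nM).
by rewrite /n mulnA -{1}(mul1n r) leq_mul2r; apply/orP; right; nia.
Qed.

Lemma weight_ok f : weight f <= max_weight -> X ^ weight f < 2 ^ w.
Proof. by move=> hf; apply: leq_ltn_trans hX; rewrite leq_exp2l. Qed.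

Lemma m0_lt a : m0 a < M.
Proof.
case: modulus_bounds => hN _ _ _ _; case: a => [|a]; first by rewrite m0_size; lia.
case: (ltnP a N.+1) => ha; first by rewrite m0_bits //; case: al; lia.
by rewrite m0_tail //; lia.
Qed.

Lemma triple_setup : triple w (fun v m => v = Env 0 0 0 0 0 0 0 /\ m = m0) setup
  (cost (Mem (Num 0)) + cost (Num 1) + cost (Num (2 ^ log_modulus)) + 3)
  (fun v m => v = Env 0 N 1 (2 ^ log_modulus) 0 0 0 /\ m = m0).
Proof.
have LM : 2 ^ log_modulus <= M by rewrite leq_exp2l // /w' mulnS leq_addr.
have mX a : m0 a <= X by apply: leq_trans MX; apply: ltnW; apply: m0_lt.
have NX : N <= X by rewrite -m0_size.
apply: triple_weaken (triple_seq (triple_assign X1 (weight_ok _))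
  (triple_seq (triple_assign X1 (weight_ok _))
    (triple_assign X1 (weight_ok _)))) _ _ (fun v m q => q).
- by rewrite /max_weight; lia.
- by rewrite /max_weight /=; lia.
- by rewrite /max_weight; lia.
- move=> v m [-> ->] /=; rewrite m0_size.
  by split; [split=> // -[] | split; [split=> // -[]|split; [split=> // -[] //=; lia|]]].
- lia.
Qed.

Lemma triple_choose_base :
  triple w (fun v m => v = Env 0 N 1 (2 ^ log_modulus) 0 0 0 /\ m = m0) choose_base
  (N.+1 * (((cost e_new_modulus).+1 + (cost e_new_base).+1) +
     cost (Op Add (Var Size) (Num 1)) + 10) +
    (cost (Op Add (Var Size) (Num 1)) + 10))
  (fun v m => v = Env 0 N r M N.+1 0 0 /\ m = m0).
Proof.
have NM : N.+2 <= M by case: modulus_bounds.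
have mX a : m0 a <= X by apply: leq_trans MX; apply: ltnW; apply: m0_lt.
pose ex := digits_exponent k N.
pose Inv j (v : env) m :=
  v = Env 0 N (k ^ ex j) (2 ^ (log_modulus * (ex j).+1)) j 0 0 /\ m = m0.
have exM j : j <= N.+1 ->
    k ^ ex j <= M /\ 2 ^ (log_modulus * (ex j).+1) <= M.
  move=> jN; have le : ex j <= e := digits_exponent_le k N jN.
  split; last by rewrite leq_exp2l // leq_mul2l ltnS le orbT.
  by apply: leq_trans rM; rewrite leq_exp2l //; lia.
have bI j v m : j <= N.+1 -> Inv j v m -> bounded X v m.
  move=> jN [-> ->]; have [h1 h2] := exM j jN.
  split=> // x; apply: leq_trans MX; case: x => //=; lia.
apply: triple_weaken (triple_for X1 (Inv := Inv) (T :=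
  (cost e_new_modulus).+1 + (cost e_new_base).+1) _ _ _) _ (leqnn _) _.
- by apply: leq_ltn_trans hX; rewrite leq_exp2l // /max_weight; lia.
- move=> j v m jN hI; split; last exact: bI hI.
    by case: hI => -> _.
  by case: hI => -> _; rewrite /= addn1.
- move=> j jN; apply: triple_weaken (triple_seq
    (triple_assign X1 (weight_ok _))
    (triple_assign X1 (weight_ok _))) _ (leqnn _) (fun v m q => q).
  + by rewrite /max_weight; lia.
  + by rewrite /max_weight; lia.
  + move=> v m hI; split; first exact: (bI j v m (ltnW jN) hI).
    have bS := bI j.+1 (set (Env 0 N (k ^ ex j.+1)
      (2 ^ (log_modulus * (ex j.+1).+1)) j 0 0) Outer j.+1) m jN.
    case: hI bS => -> -> bS; have {}bS := bS (conj erefl erefl).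
    have exS : ex j.+1 = if (k ^ ex j) ^ (2 * k) < N.+1 then (ex j).+1 else ex j.
      by [].
    have eM : den (Env 0 N (k ^ ex j) (2 ^ (log_modulus * (ex j).+1)) j 0 0) m0
        e_new_modulus = 2 ^ (log_modulus * (ex j.+1).+1).
      rewrite /e_new_modulus /e_below /= den_epow /= addn1 exS.
      case: ifP => _ /=; last by rewrite muln0 addn0 muln1.
      by rewrite muln1 add1n prednK ?expn_gt0 // -expnD -mulnSr.
    have eB M' : den (Env 0 N (k ^ ex j) M' j 0 0) m0
        e_new_base = k ^ ex j.+1.
      rewrite /e_new_base /e_below /= den_epow /= addn1 exS.
      case: ifP => _ /=; last by rewrite muln0 addn0 muln1.
      by rewrite muln1 add1n prednK // -expnSr.
    rewrite eM [set (Env _ _ _ _ _ _ _) Modulus _]/= eB /=.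
    have [h1 h2] := exM j (ltnW jN); have [h3 h4] := exM j.+1 jN.
    split; [|split=> //].
      by split=> // x; apply: leq_trans MX; case: x => //=; lia.
    by split=> // x; apply: leq_trans MX; case: x => //=; lia.
- by move=> v m [-> ->]; split; [split=> // x; apply: leq_trans MX; case: x => //=;
    have [h1 h2] := exM 0 (leq0n _); move: h2; rewrite ?muln1; lia | rewrite /Inv /= muln1].
- by [].
Qed.

Lemma triple_search_small :
  triple w (fun v m => v = Env 0 N r M N.+1 0 0 /\ m = m0) search_small
  (2 * r ^ k * N.+1 * ((cost e_found).+1 + cost e_size_bound + 10) +
    (cost e_size_bound + 10))
  (fun v m => (exists2 f : bool, (f <-> exists2 j, j < 2 * r ^ k * N.+1 &
     progression k N al j) & v = Env f N r M (2 * r ^ k * N.+1) 0 0) /\ m = m0).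
Proof.
have [NM LM _ _ _] := modulus_bounds.
have mX a : m0 a <= X by apply: leq_trans MX; apply: ltnW; apply: m0_lt.
pose Inv j (v : env) m :=
  v = Env (has (progression k N al) (iota 0 j)) N r M j 0 0 /\ m = m0.
have bI j (f : bool) : j <= M -> bounded X (Env f N r M j 0 0) m0.
  by move=> jM; split=> // x; apply: leq_trans MX; case: x => //=; try lia; case: f; lia.
apply: triple_weaken (triple_for X1 (n := 2 * r ^ k * N.+1) (Inv := Inv)
  (T := (cost e_found).+1) _ _ _) _ (leqnn _) _.
- by apply: leq_ltn_trans hX; rewrite leq_exp2l // /max_weight; lia.
- move=> j v m jN [-> ->]; split=> //; last by apply: bI; lia.
  by rewrite /e_size_bound /e_side /= den_epow addn1.
- move=> j jN; apply: triple_weaken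
    (triple_assign X1 (weight_ok _)) _ (leqnn _) (fun v m q => q).
    by rewrite /max_weight; lia.
  move=> v m [-> ->]; set v0 := Env _ _ _ _ _ _ _.
  have -> : den v0 m0 e_found = has (progression k N al) (iota 0 j.+1).
    transitivity (nat_of_bool (0 < found v0 + den v0 m0 (e_progression k))).
      by [].
    rewrite -[j.+1]addn1 iotaD has_cat (@den_e_progression k v0 m0 al) //= orbF.
    by case: (has _ _); case: (progression _ _ _ _).
  split; first by apply: bI; lia.
  split=> //; by apply: bI; lia.
- move=> v m [-> ->]; split; last by split.
  by split=> // x; apply: leq_trans MX; case: x => //=; lia.
- move=> v m [-> ->]; split=> //; exists (has (progression k N al)
    (iota 0 (2 * r ^ k * N.+1))) => //.
  split=> [/hasP[j]|[j jl hj]]; first by rewrite mem_iota => jl hj; exists j.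
  by apply/hasP; exists j => //; rewrite mem_iota.
Qed.

Lemma bounded_env (f : bool) q i off m : q <= M -> i <= M -> off <= X ->
  (forall a, m a <= X) -> bounded X (Env f N r M q i off) m.
Proof.
move=> qM iM oX hm; have [NM _ _ _ _] := modulus_bounds.
have le a : a <= M -> a <= X by move/leq_trans; apply.
split=> // -[] //=; apply: le => //; [exact: leq_trans (leq_b1 f) (ltnW M1) | lia].
Qed.

Definition entry (q j : nat) : bool :=
  edge_pred k r al (r ^ k * (q %/ cols k N r)) (r ^ k * (q %% cols k N r + 1))
    (mem [set: 'I_h]) (fun l : 'I_h => digit k r j l).

Definition with_instance (q : nat) (m : nat -> nat) (j : nat) : nat -> nat :=
  fun a => if q.+1 * M < a < (q.+1 * M).+1 + j then nat_of_bool (entry q (a - (q.+1 * M).+1))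
           else if a == q.+1 * M then n else m a.

Lemma shifted_encoding q m a :
  (forall a, q.+1 * M <= a -> m a = 0) ->
  with_instance q m (n ^ h) (q.+1 * M + a) =
  nth 0 (encode_hypergraph (shifted k r al N q)) a.
Proof.
move=> mz; rewrite /with_instance /encode_hypergraph.
case: a => [|a]; first by rewrite addn0 ltnn eqxx.
have -> : (q.+1 * M < q.+1 * M + a.+1) = true by lia.
have -> : (q.+1 * M + a.+1 < (q.+1 * M).+1 + n ^ h) = (a < n ^ h) by lia.
have -> : (q.+1 * M + a.+1 == q.+1 * M) = false by apply/eqP; lia.
have -> : q.+1 * M + a.+1 - (q.+1 * M).+1 = a by lia.
rewrite /=; case: ltnP => ha.
  rewrite (nth_map 0) ?size_iota // nth_iota // add0n.
  by congr nat_of_bool; rewrite [RHS]digit_set_edge.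
by rewrite mz ?leq_addr // nth_default // size_map size_iota.
Qed.

Lemma shifted_fits q :
  word_length_ok c' (nvertices (shifted k r al N q))
    (encode_hypergraph (shifted k r al N q)) w'.
Proof.
have [_ _ _ nhM [ncM nM]] := modulus_bounds.
apply/and3P; split=> //; first by rewrite /= size_map size_iota.
apply/allP => a; rewrite inE => /orP[/eqP -> //|/mapP[j _ ->]].
exact: leq_ltn_trans (leq_b1 _) M1.
Qed.

Lemma triple_write (f : bool) (q i : nat) (m : nat -> nat) :
  q < rows k N r * cols k N r -> i <= M ->
  (forall a, m a < M) -> (forall a, a < M -> m a = m0 a) ->
  triple w (fun v m' => v = Env f N r M q i (q.+1 * M) /\ m' = with_instance q m 0)
    write_instance
    (n ^ h * ((cost e_address + cost (e_adjacent k)).+1 + cost e_entries + 10)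
      + (cost e_entries + 10))
    (fun v m' => v = Env f N r M q (n ^ h) (q.+1 * M) /\
       m' = with_instance q m (n ^ h)).
Proof.
move=> qQ iM mM mm0; have [NM LM QM nhM [_ nM]] := modulus_bounds.
have bm j a : with_instance q m j a <= X.
  apply: leq_trans MX; rewrite /with_instance; case: ifP => _.
    by apply: leq_trans (leq_b1 _) _; apply: ltnW.
  by case: ifP => _; apply: ltnW.
have qX : q.+1 * M <= X by rewrite /X -mulnn leq_mul2r (leq_trans qQ) ?orbT // ltnW.
have bI j m' : j <= M -> (forall a, m' a <= X) ->
    bounded X (Env f N r M q j (q.+1 * M)) m'.
  by move=> jM hm'; apply: bounded_env => //; lia.
have hbits j : bits_in_memory N al (with_instance q m j).
  move=> a aN; rewrite /with_instance.
  have aM : a.+1 < M by apply: leq_trans NM.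
  have -> : (q.+1 * M < a.+1) = false by rewrite mulSn; lia.
  have -> : (a.+1 == q.+1 * M) = false by apply/eqP; rewrite mulSn; lia.
  by rewrite /= mm0 // m0_bits.
pose Inv j (v : env) (m' : nat -> nat) :=
  v = Env f N r M q j (q.+1 * M) /\ m' = with_instance q m j.
apply: triple_weaken (triple_for X1 (n := n ^ h) (Inv := Inv)
  (T := (cost e_address + cost (e_adjacent k)).+1) _ _ _) _ (leqnn _) _.
- by apply: leq_ltn_trans hX; rewrite leq_exp2l // /max_weight; lia.
- move=> j v m' jn [-> ->]; split=> //; last by apply: bI => //; lia.
  by rewrite /e_entries den_epow.
- move=> j jn; apply: triple_weaken
    (triple_store X1 (weight_ok _) (weight_ok _)) _ (leqnn _) (fun v m q => q).
  + by rewrite /max_weight; lia.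
  + by rewrite /max_weight; lia.
  + move=> v m' [-> ->]; split; first by apply: bI => //; lia.
    rewrite (@den_e_adjacent k _ _ al) //=.
    have -> : update (with_instance q m j) (q.+1 * M + (j + 1)) (entry q j) =
        with_instance q m j.+1.
      apply/funext => a; rewrite /update /with_instance.
      case: eqP => [->|ne].
        have -> : (q.+1 * M < q.+1 * M + (j + 1) < (q.+1 * M).+1 + j.+1) = true by lia.
        by have -> : q.+1 * M + (j + 1) - (q.+1 * M).+1 = j by lia.
      by have -> : (q.+1 * M < a < (q.+1 * M).+1 + j.+1) =
        (q.+1 * M < a < (q.+1 * M).+1 + j) by lia.
    split=> //; first by apply: bI => //; lia.
- by move=> v m' [-> ->]; split; [apply: bI | split].
- by [].
Qed.

Hypothesis hp : decides_within (hyperclique_problem k h) p c' T.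

Definition call_cost : nat :=
  (cost e_offset).+1 + ((cost (Var Offset) + cost (e_vertices k)).+1 +
    ((n ^ h * ((cost e_address + cost (e_adjacent k)).+1 + cost e_entries + 10)
      + (cost e_entries + 10)) + (2 * T n + reg_bound p + 5))).

Lemma triple_search_large (small : Prop) :
  triple w (fun v m => (exists2 f : bool, (f <-> small)
      & v = Env f N r M (2 * r ^ k * N.+1) 0 0) /\ m = m0)
    search_large
    (rows k N r * cols k N r * (call_cost + cost e_calls + 10) + (cost e_calls + 10))
    (fun v _ => found v != 0 <-> small \/
       exists2 q, q < rows k N r * cols k N r & has_clique k (shifted k r al N q)).
Proof.
have [NM LM QM nhM [_ nM]] := modulus_bounds.
pose Inv q (v : env) (m : nat -> nat) :=
  exists (f : bool) (i off : nat), v = Env f N r M q i off /\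
    (i <= M /\ off <= X) /\
    [/\ f <-> small \/ exists2 q', q' < q & has_clique k (shifted k r al N q'),
        forall a, a < M -> m a = m0 a,
        forall a, q.+1 * M <= a -> m a = 0 & forall a, m a < M].
have bI (f : bool) q i off m : q <= M -> i <= M -> off <= X ->
    (forall a, m a < M) -> bounded X (Env f N r M q i off) m.
  move=> qM iM oX hm; apply: bounded_env => // a.
  by apply: leq_trans MX; apply: ltnW.
apply: triple_weaken (triple_for X1 (n := rows k N r * cols k N r) (Inv := Inv)
  (T := call_cost) _ _ _) _ (leqnn _) _.
- by apply: leq_ltn_trans hX; rewrite leq_exp2l // /max_weight; lia.
- move=> q v m qQ [f [i [off [-> [[iM oX] [_ _ _ mM]]]]]]; split=> //.
    by rewrite /e_calls /e_rows /e_cols /e_side /= !den_epow.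
  by apply: bI => //; lia.
- move=> q qQ s [f [i [off [ev [[iM oX] [hf mm0 mz mM]]]]]].
  set m := memory s in mm0 mz mM.
  have qX : q.+1 * M <= X by rewrite /X -mulnn leq_mul2r (leq_trans qQ) ?orbT // ltnW.
  have hB : q.+1 * M + 2 ^ w' <= 2 ^ w.
    rewrite -/M; apply: leq_trans (_ : X <= _).
      by rewrite /X -mulnn addnC -mulSn leq_mul2r; apply/orP; right; lia.
    apply: ltnW; apply: leq_ltn_trans hX.
    by rewrite -{1}(expn1 X) leq_exp2l // /max_weight; lia.
  have ww : w' <= w.
    rewrite -(leq_exp2l w' w (ltnSn 1)); apply: leq_trans hB; exact: leq_addl.
  have w0 : 0 < w.
    by rewrite lt0n; apply: contraTneq hB => ->; rewrite -ltnNge -/M expn0; lia.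
  have A4 := @triple_call (hyperclique_problem k h) p c' T (shifted k r al N q) w w' (q.+1 * M)
    (Env f N r M q (n ^ h) (q.+1 * M)) (with_instance q m (n ^ h)) hp
    (shifted_fits q) ww w0 hB.
  have A3 := triple_seq (@triple_write f q i m qQ iM mM mm0)
    (triple_weaken A4 (P' := fun v m' => v = Env f N r M q (n ^ h) (q.+1 * M) /\
       m' = with_instance q m (n ^ h)) _ (leqnn _) (fun _ _ z => z)).
  have W1 : weight e_offset <= max_weight by rewrite /max_weight; lia.
  have W2 : weight (Var Offset) <= max_weight by rewrite /max_weight /=; lia.
  have W3 : weight (e_vertices k) <= max_weight by rewrite /max_weight; lia.
  have [||t [s' [E lt [[b hb ev'] hfr hlt]]]] := triple_seq
    (triple_assign (x := Offset) X1 (weight_ok W1))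
    (triple_seq (triple_store X1 (weight_ok W2) (weight_ok W3)) (A3 _)) (s := s).
  + move=> v m' [-> ->]; split=> // a _; exact: shifted_encoding.
  + rewrite ev -/m; have -> : den (Env f N r M q i off) m e_offset = q.+1 * M.
      by rewrite /e_offset /= addn1.
    split; first by apply: bI => //; lia.
    split; first by apply: bI => //; lia.
    split=> //; apply/funext => a; rewrite /update /with_instance /= addn0.
    by rewrite ltnS ltnNge andNb.
  exists t, s'; split=> //.
  have mM' a : memory s' a < M.
    case: (boolP (q.+1 * M <= a < q.+1 * M + 2 ^ w')) => ha; first exact: hlt.
    rewrite hfr // /with_instance; case: ifP => _.
      exact: leq_ltn_trans (leq_b1 _) M1.
    by case: ifP.
  have fr a : a < q.+1 * M \/ q.+1 * M + M <= a -> memory s' a = m a.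
    move=> ha; rewrite hfr; last by rewrite -/M; lia.
    rewrite /with_instance.
    have -> : (q.+1 * M < a < (q.+1 * M).+1 + n ^ h) = false by lia.
    by have -> : (a == q.+1 * M) = false by apply/eqP; lia.
  have ev2 : env_of s' = Env (f || b) N r M q (n ^ h) (q.+1 * M).
    by rewrite ev'; case: (b); case: (f).
  rewrite ev2; split=> //; first by apply: bI => //; lia.
  exists (f || b), (n ^ h), (q.+1 * M); split=> //; split; first by split=> //; lia.
  split=> //.
  + split=> [/orP[/hf[|[q' lq hq']]|/hb hy]|[sm|[q' lq hq']]].
    * by left.
    * by right; exists q' => //; lia.
    * by right; exists q.
    * by apply/orP; left; apply/hf; left.
    * apply/orP; move: lq; rewrite ltnS leq_eqVlt => /orP[/eqP E'|lq].
        by right; apply/hb; rewrite -E'.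
      by left; apply/hf; right; exists q'.
  + by move=> a aM; rewrite fr ?mm0 //; left; rewrite mulSn; lia.
  + by move=> a ha; rewrite fr ?mz //; move: ha; rewrite !mulSn; lia.
- move=> v m [[f hf ->] ->]; split.
    by apply: bI => //; exact: m0_lt.
  exists f, 0, 0; split=> //; split=> //; split=> //.
  + by rewrite hf; split=> [?|[//|[]//]]; left.
  + by move=> a; rewrite mul1n => ha; apply: m0_tail; lia.
  + exact: m0_lt.
- by move=> v m [f [i [off [-> [_ [hf _ _ _]]]]]]; rewrite -hf /=; case: f {hf}.
Qed.

End Run.
End Reduction.

Definition set_bits (N : nat) (A : {set 'I_N.+1}) (a : nat) : bool :=
  (a < N.+1) && (inord a \in A).

Lemma has_nontrivial_AP_nat k N (A : {set 'I_N.+1}) : 0 < k ->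
  has_nontrivial_AP k A <-> has_nat_AP k (set_bits A).
Proof.
move=> k0; split=> [[x [d [d0 H]]]|[x [d [d0 H]]]]; last first.
  exists (Posz x), (Posz d); split=> [|i ik]; first by rewrite eqz_nat -lt0n.
  have /andP[lt iA] := H i ik; exists (inord (x + i * d)) => //.
  by rewrite inordK // PoszD PoszM.
have pos (y : int) (c : nat) : 0 < c ->
    (forall i, i < k -> exists2 a : 'I_N.+1, a \in A &
       (a%:Z = y + i%:Z * c%:Z)%R) -> has_nat_AP k (set_bits A).
  move=> c0 Hy; have [a0 _ ya] := Hy 0 k0.
  have yE : y = Posz a0 by rewrite ya mul0r addr0.
  exists a0, c; split=> // i ik; have [a aA ai] := Hy i ik.
  have -> : a0 + i * c = a :> nat by move: ai; rewrite yE; lia.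
  by rewrite /set_bits ltn_ord inord_val.
case: (intP d) d0 H => [|c|c] // _ H; first exact: (pos x c.+1).
apply: (pos (x - (k.-1)%:Z * c.+1%:Z)%R c.+1) => // i ik.
have [|a aA ai] := H (k.-1 - i); first lia.
exists a => //; rewrite ai.
have -> : ((k.-1 - i)%:Z = k.-1%:Z - i%:Z)%R by lia.
by ring.
Qed.

Section Correctness.
Variables (k c' : nat) (p : program) (T : nat -> nat).
Hypothesis k3 : 2 < k.
Let h := k.-1.

Definition reduction_time (N : nat) : nat :=
  let r := k ^ exponent k N in
  (cost (Mem (Num 0)) + cost (Num 1) + cost (Num (2 ^ log_modulus k c')) + 3) +
  ((N.+1 * (((cost (e_new_modulus k c')).+1 + (cost (e_new_base k)).+1) +
     cost (Op Add (Var Size) (Num 1)) + 10) +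
    (cost (Op Add (Var Size) (Num 1)) + 10)) +
   ((2 * r ^ k * N.+1 * ((cost (e_found k)).+1 + cost (e_size_bound k) + 10) +
    (cost (e_size_bound k) + 10)) +
    (rows k N r * cols k N r * (call_cost k p T N + cost (e_calls k) + 10)
     + (cost (e_calls k) + 10)))).

Definition reduction_word : nat := (6 * log_modulus k c' * max_weight k c').+1.

Lemma reduction_decides :
  decides_within (hyperclique_problem k h) p c' T ->
  decides_within (AP_problem k) (reduction k c' p) reduction_word reduction_time.
Proof.
move=> hp [N A] w /and3P[/= hw _ _].
pose m0 a := nth 0 (encode_set (existT _ N A)) a.
pose r := k ^ exponent k N.
have hX : ((2 ^ (log_modulus k c' * (exponent k N).+1)) ^ 2) ^ max_weight k c' < 2 ^ w.
  apply: leq_trans hw; rewrite /reduction_word [N.+2 ^ _]expnS.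
  have le := modulus_le c' k3 N.
  apply: (@leq_ltn_trans (N.+2 ^ (6 * log_modulus k c' * max_weight k c'))).
    rewrite [N.+2 ^ (_ * max_weight _ _)]expnM.
    case: (max_weight k c') => // W; rewrite leq_exp2r //.
    apply: (@leq_trans ((N.+2 ^ (3 * log_modulus k c')) ^ 2)).
      by rewrite leq_exp2r.
    by rewrite -expnM leq_exp2l //; lia.
  by rewrite mulSn; have := expn_gt0 N.+2 (6 * log_modulus k c' * max_weight k c'); nia.
have b0 : bits_in_memory N (set_bits A) m0.
  move=> a aN; rewrite /m0 /= (nth_map ord0) ?size_enum_ord // /set_bits aN.
  by congr (nat_of_bool (_ \in A)); apply: val_inj; rewrite /= nth_enum_ord // inordK.
have t0 a : N.+1 < a -> m0 a = 0.
  by move=> ha; rewrite /m0 nth_default //= size_map size_enum_ord; lia.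
have al_lt a : set_bits A a -> a < N.+1 by case/andP.
have S1 := @triple_setup k c' k3 N w _ m0 hX erefl b0 t0.
have S2 := @triple_choose_base k c' k3 N w _ m0 hX erefl b0 t0.
have S3 := @triple_search_small k c' k3 N w _ m0 hX erefl b0 t0 al_lt.
have S4 := @triple_search_large k c' p T k3 N w _ m0 hX erefl b0 t0 al_lt hp
  (exists2 j, j < 2 * r ^ k * N.+1 & progression k N (set_bits A) j).
have [|t [s [E lt yes]]] := triple_seq S1 (triple_seq S2 (triple_seq S3 S4))
  (s := init_state (encode_set (existT _ N A))); first by [].
exists t, s; split=> //.
apply: (iff_trans yes); apply: iff_sym.
apply: (iff_trans (has_nontrivial_AP_nat A (ltnW (ltnW k3)))).
apply: bounded_search => //; first by rewrite expn_gt0; lia.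
by apply: coprimeXr; apply: coprimePn; lia.
Qed.

End Correctness.

(** * Running time *)

Section Side.
Variables (k N : nat).
Hypotheses (k2 : 1 < k) (N0 : 0 < N).
Let L := (k ^ exponent k N) ^ k.

Lemma side_gt0 : 0 < L.
Proof. by rewrite !expn_gt0; lia. Qed.

Lemma side_gt : N < L ^ 2.
Proof. by rewrite /L -expnM [k * 2]mulnC; apply: exponent_gt. Qed.

Lemma side_le : L ^ 2 <= k ^ (2 * k) * N.
Proof.
rewrite /L -expnM [k * 2]mulnC.
case: (exponent_le k N) => [->|].
  by rewrite expn0 exp1n muln_gt0 N0 expn_gt0; lia.
case: (exponent k N) => [|e] /= hle; first by rewrite expn0 exp1n muln_gt0 N0 expn_gt0; lia.
by rewrite expnS expnMn leq_mul2l hle orbT.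
Qed.

Lemma calls_le : rows k N (k ^ exponent k N) * cols k N (k ^ exponent k N) * L ^ 2
  <= (1 + (2 * k).+1 * k ^ (2 * k)) ^ 2 * N ^ 2.
Proof.
set K := k ^ (2 * k).
have L0 := side_gt0; have L2 := side_le.
have LN : L <= K * N by apply: leq_trans L2; rewrite -mulnn leq_pmulr.
have h0 : N %/ L * L <= N := leq_divM N L.
have hr : rows k N (k ^ exponent k N) * L <= (1 + (2 * k).+1 * K) * N.
  by rewrite /rows -/L !mulnDl mul1n -mulnA leq_add // leq_mul2l LN orbT.
have hc : cols k N (k ^ exponent k N) * L <= (1 + (2 * k).+1 * K) * N.
  apply: leq_trans hr; rewrite leq_mul2r /rows /cols; apply/orP; right; lia.
by rewrite -expnMn -!mulnn mulnACA leq_mul.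
Qed.

End Side.

Lemma time_arithmetic (a1 a2 a3 a4 a5 a6 a7 a8 a9 a10 b : nat) :
  exists C, forall N L Q H t, 0 < N -> 0 < L ->
  a1 + ((N.+1 * (a2 + a3 + 10) + (a3 + 10)) +
    ((2 * L * N.+1 * (a4 + a5 + 10) + (a5 + 10)) +
     (Q * ((a7 + (a8 + ((H * (a9 + a10 + 10) + (a10 + 10)) + (2 * t + b + 5))))
           + a6 + 10) + (a6 + 10))))
  <= C * (L * N + Q * (H + t + 1)).
Proof.
exists (a1 + 2 * (a2 + a3 + 10) + (a3 + 10) + 4 * (a4 + a5 + 10) + (a5 + 10)
  + (a6 + 10) + (a7 + a8 + (a9 + a10 + 10) + (a10 + 10) + b + 5 + 2 + a6 + 10)).
move=> N L Q H t N0 L0.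
have LN : 1 <= L * N by rewrite muln_gt0 L0.
have NL : N.+1 <= 2 * (L * N) by nia.
have NL' : 2 * L * N.+1 <= 4 * (L * N) by nia.
have e1 := leq_mul NL (leqnn (a2 + a3 + 10)).
have e2 := leq_mul NL' (leqnn (a4 + a5 + 10)).
set D := a7 + a8 + (a9 + a10 + 10) + (a10 + 10) + b + 5 + 2 + a6 + 10.
have e3 : (a7 + (a8 + (H * (a9 + a10 + 10) + (a10 + 10) + (2 * t + b + 5)))) + a6 + 10
  <= D * (H + t + 1).
  rewrite /D; move: (a9 + a10 + 10) (a10 + 10) => x y; nia.
have e4 := leq_mul (leqnn Q) e3.
set E := a1 + _ + _ + _ + _ + _; set S := Q * (H + t + 1).
have eS : Q * (D * (H + t + 1)) = D * S by rewrite /S; ring.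
rewrite eS in e4.
have -> : (E + D) * (L * N + S) = E * (L * N) + D * S + (E * S + D * (L * N)) by ring.
apply: leq_trans (leq_addr _ _).
have c1 : a1 + (a3 + 10) + (a5 + 10) + (a6 + 10) <=
    (a1 + (a3 + 10) + (a5 + 10) + (a6 + 10)) * (L * N) by rewrite leq_pmulr.
have -> : E * (L * N) = (a1 + (a3 + 10) + (a5 + 10) + (a6 + 10)) * (L * N) +
   2 * (L * N) * (a2 + a3 + 10) + 4 * (L * N) * (a4 + a5 + 10).
  by rewrite /E; ring.
move: c1 e1 e2 e4; lia.
Qed.

Lemma reduction_time_le (k c' : nat) (p : program) (T : nat -> nat) :
  1 < k -> exists C, forall N, 0 < N ->
  let r := k ^ exponent k N in let n := k * (r * r) in
  reduction_time k c' p T N <=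
    C * (r ^ k * N + rows k N r * cols k N r * (n ^ k.-1 + T n + 1)).
Proof.
move=> k2; have [C HC] := time_arithmetic
  (cost (Mem (Num 0)) + cost (Num 1) + cost (Num (2 ^ log_modulus k c')) + 3)
  ((cost (e_new_modulus k c')).+1 + (cost (e_new_base k)).+1)
  (cost (Op Add (Var Size) (Num 1))) (cost (e_found k)).+1
  (cost (e_size_bound k)) (cost (e_calls k)) (cost (e_offset)).+1
  (cost (Var Offset) + cost (e_vertices k)).+1
  (cost (e_address) + cost (e_adjacent k)).+1 (cost (e_entries k)) (reg_bound p).
by exists C => N N0; apply: HC => //; rewrite !expn_gt0; lia.
Qed.

Section Asymptotics.
Local Open Scope ring_scope.
Local Open Scope classical_set_scope.
Variable R : realType.

Lemma eqO_natP (f g : nat -> R) : f =O_\oo g <->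
  exists C : R, 0 < C /\ exists n0 : nat, forall n, (n0 <= n)%N -> `|f n| <= C * `|g n|.
Proof.
rewrite eqO_exP; split=> [[C C0 [n0 _ H]]|[C [C0 [n0 H]]]].
  by exists C; split=> //; exists n0 => n hn; apply: H.
by exists C => //; exists n0 => // n /= hn; apply: H.
Qed.

Lemma eqO_pow_bound (T : nat -> nat) (k : nat) (eps e1 : R) :
  e1 <= eps -> e1 <= k%:R ->
  (fun n => (T n)%:R : R) =O_\oo (fun n => n%:R `^ (k%:R - eps)) ->
  exists2 C : R, 0 < C & forall n, (0 < n)%N -> (T n)%:R <= C * n%:R `^ (k%:R - e1).
Proof.
move=> e1eps e1k /eqO_natP[C [C0 [n0 H]]].
exists (C + \sum_(i < n0) (T i)%:R).
  by rewrite ltr_wpDr // sumr_ge0.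
move=> n n1; have n1' : 1 <= n%:R :> R by rewrite ler1n.
have S0 : 0 <= \sum_(i < n0) (T i)%:R :> R by rewrite sumr_ge0.
have P0 : 1 <= n%:R `^ (k%:R - e1) :> R.
  have ke : 0 <= k%:R - e1 by rewrite subr_ge0.
  by have := ler_powR n1' ke; rewrite powRr0.
case: (leqP n0 n) => hn.
  have := H n hn; rewrite ger0_norm // (ger0_norm (powR_ge0 _ _)) => /le_trans; apply.
  apply: ler_pM; rewrite ?powR_ge0 ?lerDl ?(ltW C0) //.
  by apply: ler_powR => //; rewrite lerB.
apply: (@le_trans _ _ (C + \sum_(i < n0) (T i)%:R)); last first.
  by rewrite ler_peMr // addr_ge0 // ltW.
rewrite (bigD1 (Ordinal hn)) //= addrCA lerDl addr_ge0 ?(ltW C0) //.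
by rewrite sumr_ge0.
Qed.

Lemma reduction_time_bigO (k c' : nat) (p : program) (T : nat -> nat) (eps : R) :
  (3 < k)%N -> 0 < eps ->
  (fun n => (T n)%:R : R) =O_\oo (fun n => n%:R `^ (k%:R - eps)) ->
  (fun N => (reduction_time k c' p T N)%:R : R)
    =O_\oo (fun N => N%:R `^ (2 - Num.min eps 1 / k%:R)).
Proof.
move=> k4 eps0 hT; set e1 := Num.min eps 1.
have e10 : 0 < e1 by rewrite lt_min eps0 ltr01.
have e1eps : e1 <= eps by rewrite ge_min lexx.
have e11 : e1 <= 1 by rewrite ge_min lexx orbT.
have k4' : 4 <= k%:R :> R by rewrite ler_nat.
have k0 : 0 < k%:R :> R by apply: lt_le_trans k4'.
have e1k : e1 <= k%:R by apply: le_trans e11 _; apply: le_trans k4'; rewrite ler1n.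
have [C1 C10 hC1] := eqO_pow_bound e1eps e1k hT.
have kpos : (0 < k)%N by lia.
have k2 : (1 < k)%N by lia.
have [C2 hC2] := reduction_time_le c' p T k2.
set A : nat := ((1 + (2 * k).+1 * k ^ (2 * k)) ^ 2)%N.
set K : nat := (k ^ (2 * k))%N.
apply/eqO_natP; exists (C2%:R * (K%:R + (k ^ k)%:R * A%:R * (C1 + 2)) + 1).
split; first by rewrite ltr_wpDl // !(mulr_ge0, addr_ge0) // ltW.
exists 1%N => N N1; rewrite ger0_norm // (ger0_norm (powR_ge0 _ _)).
have {hC2} := hC2 N N1; cbv zeta.
set r := (k ^ exponent k N)%N; set n := (k * (r * r))%N.
set L := (r ^ k)%N; set Q := (rows k N r * cols k N r)%N => hC2.
have L0 : (0 < L)%N := side_gt0 k2 N1.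
have Lgt : (N < L ^ 2)%N := @side_gt k N k2.
have Lle : (L ^ 2 <= K * N)%N := side_le k2 N1.
have QL : (Q * L ^ 2 <= A * N ^ 2)%N := calls_le k2 N1.
have nk : (n ^ k = k ^ k * L ^ 2)%N by rewrite /n expnMn mulnn /L -!expnM [(2 * k)%N]mulnC.
have r0 : (0 < r)%N by rewrite expn_gt0 kpos.
have n1 : (0 < n)%N by rewrite !muln_gt0 r0 kpos.
set x : R := N%:R; have x1 : 1 <= x by rewrite ler1n.
have x0 : 0 < x by apply: lt_le_trans x1.
have xn0 : x != 0 by rewrite gt_eqF.
set y : R := n%:R; have y1 : 1 <= y by rewrite ler1n.
have y0 : 0 < y by apply: lt_le_trans y1.
have yn0 : y != 0 by rewrite gt_eqF.
set d := e1 / k%:R.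
have d0 : 0 <= d by rewrite divr_ge0 // ltW.
have d2 : d <= 2^-1.
  rewrite /d ler_pdivrMr //; apply: le_trans e11 _.
  by move: k4'; lra.
set P := y `^ (k%:R - e1).
have P1 : 1 <= P.
  have ke : 0 <= k%:R - e1 by rewrite subr_ge0.
  by have := ler_powR y1 ke; rewrite powRr0.
have Ph : (n ^ k.-1)%:R <= P.
  rewrite natrX -/y -powR_mulrn ?(ltW y0) // /P; apply: ler_powR => //.
  have -> : k%:R = k.-1%:R + 1 :> R by rewrite natr1 prednK.
  by rewrite -addrA lerDl subr_ge0.
have xy : x `^ d <= y `^ e1.
  have -> : e1 = k%:R * d by rewrite /d mulrCA divff ?mulr1 // gt_eqF.
  rewrite [y `^ _]powRrM powR_mulrn ?(ltW y0) //; apply: ge0_ler_powR => //.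
  - by rewrite nnegrE ltW.
  - by rewrite nnegrE exprn_ge0 // ltW.
  rewrite -natrX ler_nat nk; apply: leq_trans (ltnW Lgt) _.
  by rewrite leq_pmull // expn_gt0 kpos.
have QP : Q%:R * P <= (k ^ k)%:R * A%:R * x `^ (2 - d).
  rewrite /P powRB ?yn0 ?implybT // powR_mulrn ?(ltW y0) // /y -natrX nk mulrA.
  rewrite powRB ?xn0 ?implybT // powR_mulrn ?(ltW x0) // /x -natrX [leRHS]mulrA.
  apply: ler_pM; first by rewrite mulr_ge0.
  - by rewrite invr_ge0 powR_ge0.
  - by rewrite -!natrM ler_nat mulnCA -mulnA leq_mul2l QL orbT.
  - by rewrite lef_pV2 // ?posrE ?powR_gt0.
have LN : (L * N)%:R <= K%:R * x `^ (2 - d).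
  have h : L%:R <= K%:R * x `^ 2^-1.
    rewrite powR12_sqrt ?(ltW x0) //.
    have nn : 0 <= K%:R * Num.sqrt x by rewrite mulr_ge0 ?sqrtr_ge0.
    rewrite -(ler_pXn2r (isT : (0 < 2)%N)) ?nnegrE //.
    rewrite exprMn sqr_sqrtr ?(ltW x0) // -!natrX -natrM ler_nat.
    apply: leq_trans Lle _; rewrite leq_mul2r -{1}(expn1 K) leq_pexp2l ?orbT //.
    by rewrite expn_gt0 kpos.
  rewrite natrM; apply: (@le_trans _ _ (K%:R * x `^ 2^-1 * x)).
    by rewrite ler_wpM2r // ltW.
  rewrite -mulrA ler_wpM2l // -{2}(powRr1 (ltW x0)) -powRD ?xn0 ?implybT //.
  by apply: ler_powR => //; lra.
apply: (@le_trans _ _ (C2 * (L * N + Q * (n ^ k.-1 + T n + 1)))%:R).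
  by rewrite ler_nat.
rewrite natrM natrD mulrDl.
apply: (@le_trans _ _ (C2%:R * (K%:R + (k ^ k)%:R * A%:R * (C1 + 2)) * x `^ (2 - d))).
  rewrite -mulrA ler_wpM2l // mulrDl; apply: lerD => //.
  rewrite natrM; apply: (@le_trans _ _ (Q%:R * (P * (C1 + 2)))).
    rewrite ler_wpM2l // !natrD; have := hC1 n n1; rewrite -/y -/P.
    by move: Ph P1; lra.
  by rewrite mulrA [leRHS]mulrAC ler_wpM2r // addr_ge0 // ltW.
by rewrite lerDl mul1r powR_ge0.
Qed.

End Asymptotics.

Theorem theorem5p2 (R : realType) (k : nat) (hk : 4 <= k) :
  AP_hypothesis R k -> hyperclique_hypothesis R k k.-1.
Proof.
move=> hAP eps eps0 [p [c [T [hp hT]]]].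
have k0 : (0 < k%:R :> R)%R by rewrite ltr0n; lia.
apply: (hAP (Num.min eps 1 / k%:R)%R).
  by rewrite divr_gt0 // lt_min eps0 ltr01.
exists (reduction k c p), (reduction_word k c), (reduction_time k c p T).
split; first by apply: reduction_decides => //; lia.
exact: reduction_time_bigO.
Qed.
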